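(* Let $\mathcal{R}\subset\mathbb{R}\mathbb{P}^2$ be the rhombic dodecahedron code, i.e. the seven-point set consisting of the lines in $\mathbb{R}^3$ spanned by $(1,0,0)$, $(0,1,0)$, $(0,0,1)$, $(1,1,1)$, $(1,1,-1)$, $(1,-1,1)$, $(1,-1,-1)$. Then: (1) $\mathcal{R}$ is universally optimal in $\mathbb{R}\mathbb{P}^2$: for every completely monotonic function $f\colon(0,1]\to\mathbb{R}$ and every seven-point subset $\mathcal{C}\subset\mathbb{R}\mathbb{P}^2$, $E_f(\mathcal{C})\ge E_f(\mathcal{R})$. (2) If $f\colon(0,1]\to\mathbb{R}$ is completely monotonic and is not a linear function (i.e. not a polynomial of degree at most $1$), then $\mathcal{R}$ is the unique global minimum up to isometry: every seven-point subset $\mathcal{C}\subset\mathbb{R}\mathbb{P}^2$ with $E_f(\mathcal{C})=E_f(\mathcal{R})$ is the image of $\mathcal{R}$ under an isometry of $\mathbb{R}\mathbb{P}^2$. (3) $\mathcal{R}$ is the unique optimal seven-point code in $\mathbb{R}\mathbb{P}^2$ up to isometry: it maximizes the minimal distance between distinct points among all seven-point subsets of $\mathbb{R}\mathbb{P}^2$, and every seven-point subset attaining this maximum is the image of $\mathcal{R}$ under an isometry of $\mathbb{R}\mathbb{P}^2$.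
   Context: Points of $\mathbb{R}\mathbb{P}^{2}$ are lines through the origin in $\mathbb{R}^3$, each represented by a unit vector determined up to sign. The metric on $\mathbb{R}\mathbb{P}^2$ is the chordal metric $d(x,y)=\sqrt{1-\langle x,y\rangle^2}$, where $x,y$ are unit vector representatives. Isometries of $\mathbb{R}\mathbb{P}^2$ are the maps induced by elements of the orthogonal group $O(3)$. For a function $f\colon(0,1]\to\mathbb{R}$ (a potential function of squared chordal distance) and a finite set $\mathcal{C}\subset\mathbb{R}\mathbb{P}^2$, the energy is $E_f(\mathcal{C})=\frac12\sum_{x,y\in\mathcal{C},\,x\ne y} f\big(d(x,y)^2\big)$. A function $f$ is completely monotonic if it is infinitely differentiable and $(-1)^k f^{(k)}\ge 0$ for all integers $k\ge 0$. *)

(* Defs.v *)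
From HB Require Import structures.
From mathcomp Require Import all_boot all_order all_algebra finmap.
From mathcomp Require Import all_classical all_reals all_analysis.
Import Order.TTheory GRing.Theory Num.Theory.
Import numFieldNormedType.Exports.

Set Implicit Arguments.
Unset Strict Implicit.
Unset Printing Implicit Defensive.

Local Open Scope classical_set_scope.
Local Open Scope ring_scope.
Local Open Scope fset_scope.

Section ProjectivePlane.
Variable R : realType.

Definition RP2 : choiceType := {U : {vspace 'rV[R]_3} | \dim U == 1%N}.

Lemma dim_RP2 (x : RP2) : \dim (\val x) = 1%N.
Proof. by apply/eqP; exact: valP x. Qed.

Fact line_subproof (v : 'rV[R]_3) : v != 0 -> \dim <[v]>%VS == 1%N.
Proof. by move=> v0; rewrite dim_vline v0. Qed.

Definition line (v : 'rV[R]_3) (v0 : v != 0) : RP2 :=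
  Sub <[v]>%VS (line_subproof v0).

Definition dot (u v : 'rV[R]_3) : R := \sum_(i < 3) u 0 i * v 0 i.

(* The sign of the representative is arbitrary; by [chordalE], distances do not
   depend on it. *)
Definition unit_rep (x : RP2) : 'rV[R]_3 :=
  (Num.sqrt (dot (vpick (\val x)) (vpick (\val x))))^-1 *: vpick (\val x).

Definition chordal (x y : RP2) : R :=
  Num.sqrt (1 - dot (unit_rep x) (unit_rep y) ^+ 2).

Lemma dotC u v : dot u v = dot v u.
Proof. by apply: eq_bigr => i _; rewrite mulrC. Qed.

Lemma dotZl a u v : dot (a *: u) v = a * dot u v.
Proof. by rewrite /dot mulr_sumr; apply: eq_bigr => i _; rewrite mxE mulrA. Qed.

Lemma dotZr a u v : dot u (a *: v) = a * dot u v.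
Proof. by rewrite dotC dotZl dotC. Qed.

Lemma dot_gt0 u : u != 0 -> 0 < dot u u.
Proof.
move=> u0; have d0 : 0 <= dot u u by apply: sumr_ge0 => i _; rewrite -expr2 sqr_ge0.
rewrite lt_neqAle d0 andbT eq_sym; apply: contra u0 => /eqP d.
apply/eqP/rowP => i; rewrite mxE; apply/eqP; rewrite -sqrf_eq0 expr2.
have h j : true -> 0 <= u 0 j * u 0 j by rewrite -expr2 sqr_ge0.
by have /(_ i)-> := psumr_eq0P (F := fun j => u 0 j * u 0 j) (fun j _ => h j isT) d.
Qed.

Lemma vpick_RP2 (x : RP2) : vpick (\val x) != 0.
Proof. by rewrite vpick0 -dimv_eq0 (dim_RP2 x). Qed.

Lemma unit_rep_in (x : RP2) : unit_rep x \in \val x.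
Proof. by rewrite memvZ ?memv_pick. Qed.

Lemma unit_rep_unit (x : RP2) : dot (unit_rep x) (unit_rep x) = 1.
Proof.
have d0 := dot_gt0 (vpick_RP2 x).
rewrite /unit_rep dotZl dotZr mulrA -expr2 exprVn sqr_sqrtr ?ltW //.
by rewrite mulVf // gt_eqF.
Qed.

Lemma unit_repE (x : RP2) u : u \in \val x -> dot u u = 1 ->
  exists2 e : R, e ^+ 2 = 1 & unit_rep x = e *: u.
Proof.
move=> ux u1.
have u0 : u != 0.
  apply/eqP => u0; move: u1; rewrite u0 /dot big1 => [/eqP|i _].
    by rewrite eq_sym oner_eq0.
  by rewrite mxE mul0r.
have xE : (<[u]> = \val x)%VS.
  by apply/eqP; rewrite eqEdim -memvE ux dim_vline u0 (dim_RP2 x).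
have := unit_rep_in x; rewrite -xE => /vlineP[e eE]; exists e => //.
by have := unit_rep_unit x; rewrite eE dotZl dotZr u1 mulr1 -expr2.
Qed.

Lemma chordalE (x y : RP2) u v : u \in \val x -> v \in \val y ->
  dot u u = 1 -> dot v v = 1 -> chordal x y = Num.sqrt (1 - dot u v ^+ 2).
Proof.
move=> ux vy u1 v1; rewrite /chordal.
have [a a1 ->] := unit_repE ux u1; have [b b1 ->] := unit_repE vy v1.
by rewrite dotZl dotZr !exprMn a1 b1 !mul1r.
Qed.

Definition O3 := {A : 'M[R]_3 | A *m A^T == 1%:M}.

Definition O3_lfun (A : O3) : 'End('rV[R]_3) := linfun (mulmxr (\val A)).

Fact RP2_isometry_subproof (A : O3) (x : RP2) :
  \dim (O3_lfun A @: \val x)%VS == 1%N.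
Proof.
have kerA : lker (O3_lfun A) == 0%VS.
  apply/lker0P => u v; rewrite !lfunE /= => /(congr1 (mulmx^~ (\val A)^T)).
  have AA : \val A *m (\val A)^T = 1%:M by apply/eqP; exact: valP A.
  by rewrite -!mulmxA AA !mulmx1.
by rewrite limg_dim_eq ?dim_RP2 // (eqP kerA) capv0.
Qed.

Definition RP2_isometry (A : O3) (x : RP2) : RP2 :=
  Sub (O3_lfun A @: \val x)%VS (RP2_isometry_subproof A x).

Definition isometric (C D : {fset RP2}) :=
  exists A : O3, D = [fset RP2_isometry A x | x in C].

(* [f] stands for a potential on the interval ]0, 1], where the squared distances
   of distinct points lie; its other values play no role. *)
Definition energy (f : R -> R) (C : {fset RP2}) : R :=
  2^-1 * \sum_(x <- C) \sum_(y <- C | y != x) f (chordal x y ^+ 2).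

(* The neutral element [1] is harmless, as [chordal] is at most [1]:
   see [min_dist_attained] and [min_dist_le]. *)
Definition min_dist (C : {fset RP2}) : R :=
  \big[Num.min/1]_(x <- C) \big[Num.min/1]_(y <- C | y != x) chordal x y.

Lemma chordal_le1 x y : chordal x y <= 1.
Proof. by rewrite -[leRHS]sqrtr1 ler_wsqrtr // gerBl sqr_ge0. Qed.

Lemma min_dist_le (C : {fset RP2}) x y :
  x \in C -> y \in C -> y != x -> min_dist C <= chordal x y.
Proof.
move=> xC yC yx; rewrite /min_dist; apply: (@bigmin_inf_seq _ _ _ (enum_fset C) _ x) => //.
by apply: (@bigmin_inf_seq _ _ _ (enum_fset C) _ y).
Qed.

Lemma min_dist_attained (C : {fset RP2}) : (1 < #|` C|)%N ->
  exists x y, [/\ x \in C, y \in C, y != x & min_dist C = chordal x y].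
Proof.
move=> C1.
have [x [y [xC yC yx]]] : exists x y, [/\ x \in C, y \in C & y != x].
  have /fset0Pn[x xC] : C != fset0 by rewrite -cardfs_gt0 (ltn_trans _ C1).
  have /fset0Pn[y] : C `\ x != fset0.
    by rewrite -cardfs_gt0 -ltnS; move: C1; rewrite (cardfsD1 x) xC.
  by rewrite in_fsetD1 => /andP[yx yC]; exists x, y.
pose P (r : R) := r = 1 \/
  exists x y, [/\ x \in C, y \in C, y != x & r = chordal x y].
have minP a b : P a -> P b -> P (Num.min a b) by rewrite minEle; case: ifP.
have : P (min_dist C).
  rewrite /min_dist big_seq; apply: big_ind => //; first by left.
  move=> z zC; rewrite big_seq_cond; apply: big_ind => //; first by left.
  by move=> t /andP[tC tz]; right; exists z, t.
case=> // m1; exists x, y; split=> //; apply/eqP.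
by rewrite eq_le min_dist_le //= m1 chordal_le1.
Qed.

(* Integer coordinates, so that the nonvanishing condition in [line3] is
   decided by computation. *)
Definition vec3 (a b c : int) : 'rV[R]_3 :=
  \row_(i < 3) ([:: a; b; c]`_i)%:~R.

Fact vec3_neq0 a b c : [|| a != 0, b != 0 | c != 0] -> vec3 a b c != 0.
Proof.
move=> h; apply/eqP => /rowP v0.
have := v0 0; have := v0 1; have := v0 (2%:R); rewrite !mxE /=.
move=> /eqP; rewrite intr_eq0 => /eqP c0 /eqP.
rewrite intr_eq0 => /eqP b0 /eqP; rewrite intr_eq0 => /eqP a0.
by move: h; rewrite a0 b0 c0.
Qed.

Definition line3 (a b c : int) (h : [|| a != 0, b != 0 | c != 0]) : RP2 :=
  line (vec3_neq0 h).

Definition rhombic_dodecahedron : {fset RP2} :=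
  [fset @line3 1 0 0 isT; @line3 0 1 0 isT; @line3 0 0 1 isT;
        @line3 1 1 1 isT; @line3 1 1 (-1) isT;
        @line3 1 (-1) 1 isT; @line3 1 (-1) (-1) isT].

Lemma line3_inj a b c a' b' c' h h' : @line3 a b c h = @line3 a' b' c' h' ->
  [/\ a * b' = a' * b, a * c' = a' * c & b * c' = b' * c].
Proof.
move=> /(congr1 val) /= E; have : vec3 a b c \in <[vec3 a' b' c']>%VS.
  by rewrite -E memv_line.
move=> /vlineP[k /rowP v].
have := v 0; have := v 1; have := v (2%:R); rewrite !mxE /= => cE bE aE.
split; apply: (@intr_inj R); rewrite !intrM ?aE ?bE ?cE;
by rewrite -!mulrA mulrCA; congr (_ * _); rewrite mulrC.
Qed.

Lemma line3_neq a b c a' b' c' h h' :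
  [|| a * b' != a' * b, a * c' != a' * c | b * c' != b' * c] ->
  (@line3 a b c h == @line3 a' b' c' h') = false.
Proof.
by move=> n; apply/negbTE/eqP => /line3_inj[e1 e2 e3]; rewrite e1 e2 e3 !eqxx in n.
Qed.

Lemma card_rhombic_dodecahedron : #|` rhombic_dodecahedron| = 7%N.
Proof.
have card7 (K : choiceType) (a b c d e f g : K) :
    pairwise (fun x y => x != y) [:: a; b; c; d; e; f; g] ->
    #|` [fset a; b; c; d; e; f; g]| = 7%N.
  rewrite -uniq_pairwise => us.
  have -> : [fset a; b; c; d; e; f; g] = [fset x in [:: a; b; c; d; e; f; g]].
    by apply/fsetP => x; rewrite !inE orbF -!orbA.
  by rewrite card_fseq undup_id.
apply: card7; rewrite [pairwise _ _]/=.
by repeat (apply/andP; split); rewrite ?line3_neq.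
Qed.

(* Derivatives are taken within [D], hence one-sidedly at an endpoint of [D]
   that belongs to [D]; values of [f] outside [D] are irrelevant on [D]. *)
Definition diff_quotient (f : R -> R) (x y : R) : R := (f y - f x) / (y - x).

Definition derivable_within (D : set R) (f : R -> R) (x : R) : Prop :=
  cvg (diff_quotient f x @ within D x^').

Definition derive_within (D : set R) (f : R -> R) (x : R) : R :=
  lim (diff_quotient f x @ within D x^').

Definition deriven_within (D : set R) (k : nat) (f : R -> R) : R -> R :=
  iter k (derive_within D) f.

Definition infinitely_differentiable (D : set R) (f : R -> R) : Prop :=
  forall (k : nat) x, D x -> derivable_within D (deriven_within D k f) x.

Definition completely_monotonic (f : R -> R) : Prop :=
  let D := [set` `]0, 1]] in
  infinitely_differentiable D f /\
  forall (k : nat) x, D x -> 0 <= (-1) ^+ k * deriven_within D k f x.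

Definition linear_function (f : R -> R) : Prop :=
  exists2 p : {poly R}, (size p <= 2)%N & {in `]0, 1], forall x, f x = p.[x]}.

End ProjectivePlane.

(* Main.v *)
Require Import Defs.
From Stdlib Require Import ZArith.
From HB Require Import structures.
From mathcomp Require Import all_boot all_order all_algebra finmap.
From mathcomp Require Import all_classical all_reals all_analysis.
From mathcomp Require Import ssrZ zify ring lra.
Import Order.TTheory GRing.Theory Num.Theory.
Import numFieldNormedType.Exports.

Set Implicit Arguments.
Unset Strict Implicit.
Unset Printing Implicit Defensive.

Local Open Scope ring_scope.

(* A seven-point code is a family of unit vectors [x_i]; with [t_ij = (x_i.x_j)^2]
   its energy is a sum of [g t_ij] where [g t = f (1 - t)], and the rhombic
   dodecahedron has [t = 0], [1/9] and [1/3] for 3, 6 and 12 of its pairs.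

   If [f] is completely monotonic, the Taylor polynomials of [g] at 0 have
   nonnegative coefficients and converge to [g] on [0, 1[ (Bernstein), so it is
   enough to treat polynomials [p] with nonnegative coefficients. Dividing by [X],
   then twice by [X - 1/9], then twice by [X - 1/3] writes
     p = c0 + c1 t + c2 t(t-1/9) + c3 t(t-1/9)^2 + c4 t(t-1/9)^2(t-1/3)
         + q t(t-1/9)^2(t-1/3)^2
   where the [c_i] and the coefficients of [q] are nonnegative. The term in [c1] is
   minimal for tight frames. For the terms in [c2], [c3], [c4] there are sharp
   three-point bounds: summed over triples [(x, y, z)] of points of the code, with
   [u = x.y], [v = x.z], [w = y.z], the excess of energy is a combination with
   nonnegative weights of [l(u) l(v) Q_k(u, v, w)], where [Q_k] is the reproducing
   kernel of order [k] for the rotations fixing [x], and, over the triples of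
   distinct points, of squares of polynomials in [u, v, w]. These combinations come from
   semidefinite programs, solved numerically and rounded to exact integer solutions.

   The bound in [c2] is strengthened by small multiples of the nonnegative
   quantities "sum of t(t-1/9)^2(t-1/3)^2" and "defect of tightness". In case of
   equality the code is thus a tight frame with [t] in [{0, 1/9, 1/3}]; then each
   point sees either 2, 0, 4 or 0, 3, 3 of these values, the second case cannot hold
   for all seven points by parity, and a point of the first kind extends to an
   orthonormal basis formed of points of the code, in which the four other points
   are the diagonals of the cube. The bound in [c4] gives the statement on optimal
   codes, since [t(t-1/9)^2(t-1/3)] is nonpositive if all [t] are at most 1/3. *)

(** * Integer polynomials in three variables *)

Definition mono := (nat * nat * nat)%type.
(** Sparse polynomials serve as input and as multipliers. Dense ones, nested by the exponents of u,
    v, t in this order, collect like terms automatically, so that an identity becomes a test of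
    coefficients. *)
Definition spoly := seq (Z * mono).
Definition dpoly := seq (seq (seq Z)).

Fixpoint zipadd (A : Type) (add : A -> A -> A) (s t : seq A) : seq A :=
  match s, t with
  | [::], _ => t
  | _, [::] => s
  | x :: s', y :: t' => add x y :: zipadd add s' t'
  end.

Definition dadd : dpoly -> dpoly -> dpoly := zipadd (zipadd (zipadd Z.add)).

Definition dmono (z : Z) (m : mono) (D : dpoly) : dpoly :=
  ncons m.1.1 [::] [seq ncons m.1.2 [::]
    [seq ncons m.2 Z0 [seq Z.mul z x | x <- s] | s <- r] | r <- D].

Definition smul (p : spoly) (D : dpoly) : dpoly :=
  foldr (fun t acc => dadd (dmono t.1 t.2 D) acc) [::] p.

Definition dense_form (p : spoly) : dpoly := smul p [:: [:: [:: Zpos xH]]].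

Fixpoint terms1 (a b c : nat) (s : seq Z) : spoly :=
  if s is z :: s' then (z, (a, b, c)) :: terms1 a b c.+1 s' else [::].

Fixpoint terms2 (a b : nat) (r : seq (seq Z)) : spoly :=
  if r is s :: r' then terms1 a b 0 s ++ terms2 a b.+1 r' else [::].

Fixpoint terms3 (a : nat) (D : dpoly) : spoly :=
  if D is r :: D' then terms2 a 0 r ++ terms3 a.+1 D' else [::].

Definition terms (D : dpoly) : spoly := terms3 0 D.

Definition dzero (D : dpoly) : bool := all (all (all (Z.eqb Z0))) D.

Fixpoint lincomb (row : seq Z) (ps : seq dpoly) : dpoly :=
  match row, ps with
  | x :: row', p :: ps' => dadd (dmono x (0, 0, 0)%N p) (lincomb row' ps')
  | _, _ => [::]
  end.

Fixpoint dotprod (ps : seq spoly) (gs : seq dpoly) : dpoly :=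
  match ps, gs with
  | p :: ps', g :: gs' => dadd (smul p g) (dotprod ps' gs')
  | _, _ => [::]
  end.

(* A block stands for the polynomial
   [common_factor * \sum_((w, r) <- rows) w * (r . left_basis) * (r . right_basis)]. *)
Record block := Block {
  left_basis : seq spoly;
  right_basis : seq spoly;
  common_factor : spoly;
  rows : seq (Z * seq Z) }.

(** The Gram matrix is applied to the right basis first; [dotprod] then multiplies by the sparse
    left basis, and no product of two dense polynomials is formed. *)
Definition gram_mul (rows : seq (Z * seq Z)) (qs : seq dpoly) : seq dpoly :=
  foldr (fun r acc => let c := lincomb r.2 qs in
    zipadd dadd [seq dmono (Z.mul r.1 x) (0, 0, 0)%N c | x <- r.2] acc) [::] rows.

Definition block_poly (B : block) : dpoly :=
  smul (common_factor B) (dotprod (left_basis B)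
    (gram_mul (rows B) [seq dense_form q | q <- right_basis B])).

Definition blocks_poly (Bs : seq block) : dpoly :=
  foldr (fun B acc => dadd (block_poly B) acc) [::] Bs.

Definition weights_ge0 (B : block) : bool := all (fun r => Z.leb Z0 r.1) (rows B).

(** * Values of the polynomials under a moment functional *)

Section Evaluation.
Variable R : comNzRingType.

Definition zr (z : Z) : R := (int_of_Z z)%:~R.

Lemma zrD x y : zr (Z.add x y) = zr x + zr y.
Proof. by rewrite /zr -intrD -rmorphD. Qed.

Lemma zrM x y : zr (Z.mul x y) = zr x * zr y.
Proof. by rewrite /zr -intrM -rmorphM. Qed.

Lemma zr0 : zr Z0 = 0. Proof. by []. Qed.
Lemma zr1 : zr (Zpos xH) = 1. Proof. by []. Qed.

(* Polynomials are interpreted with respect to an arbitrary moment functional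
   [M], the value of [u ^ a * v ^ b * t ^ c] being [M a b c]. *)
Fixpoint ev1 (M : nat -> R) (s : seq Z) : R :=
  if s is z :: s' then zr z * M 0 + ev1 (fun k => M k.+1) s' else 0.

Fixpoint ev2 (M : nat -> nat -> R) (r : seq (seq Z)) : R :=
  if r is s :: r' then ev1 (M 0) s + ev2 (fun j => M j.+1) r' else 0.

Fixpoint ev3 (M : nat -> nat -> nat -> R) (D : dpoly) : R :=
  if D is r :: D' then ev2 (M 0) r + ev3 (fun i => M i.+1) D' else 0.

Definition evs (M : nat -> nat -> nat -> R) (p : spoly) : R :=
  \sum_(t <- p) zr t.1 * M t.2.1.1 t.2.1.2 t.2.2.

Lemma ev1D M s t : ev1 M (zipadd Z.add s t) = ev1 M s + ev1 M t.
Proof.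
elim: s t M => [|x s IH] [|y t] M //=; rewrite ?(add0r, addr0) //.
by rewrite IH zrD mulrDl addrACA.
Qed.

Lemma ev2D M s t : ev2 M (zipadd (zipadd Z.add) s t) = ev2 M s + ev2 M t.
Proof.
elim: s t M => [|x s IH] [|y t] M //=; rewrite ?(add0r, addr0) //.
by rewrite IH ev1D addrACA.
Qed.

Lemma ev3D M s t : ev3 M (dadd s t) = ev3 M s + ev3 M t.
Proof.
rewrite /dadd; elim: s t M => [|x s IH] [|y t] M //=; rewrite ?(add0r, addr0) //.
by rewrite IH ev2D addrACA.
Qed.

Lemma ev1_mono M z c s :
  ev1 M (ncons c Z0 [seq Z.mul z x | x <- s]) = zr z * ev1 (fun k => M (c + k)%N) s.
Proof.
elim: c M => [|c IH] M /=; last by rewrite IH zr0 mul0r add0r.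
elim: s M => [|x s IH] M /=; first by rewrite mulr0.
by rewrite (IH (fun k => M k.+1)) zrM mulrDr mulrA.
Qed.

Lemma ev2_mono M z b c r :
  ev2 M (ncons b [::] [seq ncons c Z0 [seq Z.mul z x | x <- s] | s <- r])
  = zr z * ev2 (fun j k => M (b + j)%N (c + k)%N) r.
Proof.
elim: b M => [|b IH] M /=; last by rewrite IH add0r.
elim: r M => [|s r IH] M /=; first by rewrite mulr0.
by rewrite (IH (fun k => M k.+1)) ev1_mono mulrDr.
Qed.

Lemma ev3_mono M z m D :
  ev3 M (dmono z m D) =
  zr z * ev3 (fun i j k => M (m.1.1 + i)%N (m.1.2 + j)%N (m.2 + k)%N) D.
Proof.
case: m => [[a b] c]; rewrite /dmono /=.
elim: a M => [|a IH] M /=; last by rewrite IH add0r.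
elim: D M => [|r D IH] M /=; first by rewrite mulr0.
by rewrite (IH (fun k => M k.+1)) ev2_mono mulrDr.
Qed.

Lemma ev3_smul M p D : ev3 M (smul p D) = \sum_(t <- p) zr t.1 *
  ev3 (fun i j k => M (t.2.1.1 + i)%N (t.2.1.2 + j)%N (t.2.2 + k)%N) D.
Proof.
elim: p => [|t p IH] /=; first by rewrite big_nil.
by rewrite ev3D ev3_mono IH big_cons.
Qed.

Lemma ev3_dense_form M p : ev3 M (dense_form p) = evs M p.
Proof.
rewrite /dense_form ev3_smul; apply: eq_bigr => t _ /=.
by rewrite zr1 mul1r !addr0 !addn0.
Qed.

Lemma evs_cat M p q : evs M (p ++ q) = evs M p + evs M q.
Proof. by rewrite /evs big_cat. Qed.

Lemma eq_ev1 M N s : M =1 N -> ev1 M s = ev1 N s.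
Proof. by elim: s M N => [|z s IH] M N E //=; rewrite E (IH _ (fun k => N k.+1)). Qed.

Lemma eq_ev2 M N r : M =2 N -> ev2 M r = ev2 N r.
Proof.
elim: r M N => [|s r IH] M N E //=.
by rewrite (eq_ev1 _ (E 0%N)) (IH _ (fun k => N k.+1)).
Qed.

Lemma eq_ev3 M N D : (forall a b c, M a b c = N a b c) -> ev3 M D = ev3 N D.
Proof.
elim: D M N => [|r D IH] M N E //=.
by rewrite (eq_ev2 _ (E 0%N)) (IH _ (fun k => N k.+1)).
Qed.

Lemma evs_terms1 M a b c s :
  evs M (terms1 a b c s) = ev1 (fun k => M a b (c + k)%N) s.
Proof.
elim: s c => [|z s IH] c /=; first by rewrite /evs big_nil.
rewrite -cat1s evs_cat IH /evs big_seq1 addn0; congr (_ + _).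
by apply: eq_ev1 => k; rewrite addnS.
Qed.

Lemma evs_terms2 M a b r : evs M (terms2 a b r) = ev2 (fun j => M a (b + j)%N) r.
Proof.
elim: r b => [|s r IH] b /=; first by rewrite /evs big_nil.
rewrite evs_cat IH evs_terms1 !addn0; congr (_ + _).
by apply: eq_ev2 => j k; rewrite addnS.
Qed.

Lemma evs_terms M D : evs M (terms D) = ev3 M D.
Proof.
suff E a : evs M (terms3 a D) = ev3 (fun i => M (a + i)%N) D by rewrite /terms E.
elim: D a => [|r D IH] a /=; first by rewrite /evs big_nil.
rewrite evs_cat IH evs_terms2 addn0; congr (_ + _).
by apply: eq_ev3 => i j k; rewrite addnS.
Qed.

Lemma zr_eqb z : Z.eqb Z0 z -> zr z = 0.
Proof. by move=> /Z.eqb_spec <-. Qed.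

Lemma dzeroP M D : dzero D -> ev3 M D = 0.
Proof.
rewrite /dzero; elim: D M => [|r D IH] M //= /andP[r0 /IH->]; rewrite addr0.
elim: r (M 0%N) r0 => [|s r IHr] N //= /andP[s0 /IHr->]; rewrite addr0.
elim: s (N 0%N) s0 => [|z s IHs] P //= /andP[z0 /IHs->].
by rewrite zr_eqb // mul0r addr0.
Qed.

Definition pt (u v t : R) (a b c : nat) : R := u ^+ a * v ^+ b * t ^+ c.

Lemma ev1Z M x s : ev1 (fun k => x * M k) s = x * ev1 M s.
Proof.
elim: s M => [|z s IH] M /=; first by rewrite mulr0.
by rewrite (IH (fun k => M k.+1)) mulrDr mulrCA.
Qed.

Lemma ev2Z M x r : ev2 (fun j k => x * M j k) r = x * ev2 M r.
Proof.
elim: r M => [|s r IH] M /=; first by rewrite mulr0.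
by rewrite (IH (fun k => M k.+1)) ev1Z mulrDr.
Qed.

Lemma ev3Z M x D : ev3 (fun i j k => x * M i j k) D = x * ev3 M D.
Proof.
elim: D M => [|r D IH] M /=; first by rewrite mulr0.
by rewrite (IH (fun k => M k.+1)) ev2Z mulrDr.
Qed.

Section Point.
Variables u v t : R.
Local Notation M := (pt u v t).

Lemma ev3_pt_mono z m D :
  ev3 M (dmono z m D) = zr z * M m.1.1 m.1.2 m.2 * ev3 M D.
Proof.
rewrite ev3_mono -(mulrA (zr z)) -[in RHS]ev3Z; congr (zr _ * _).
by apply: eq_ev3 => i j k; rewrite /pt !exprD; ring.
Qed.

Lemma ev3_pt_smul p D : ev3 M (smul p D) = evs M p * ev3 M D.
Proof.
elim: p => [|s p IH] /=; first by rewrite /evs big_nil mul0r.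
by rewrite ev3D ev3_pt_mono IH /evs big_cons mulrDl.
Qed.

Fixpoint dotr (row : seq Z) (xs : seq R) : R :=
  match row, xs with
  | z :: row', x :: xs' => zr z * x + dotr row' xs'
  | _, _ => 0
  end.

Lemma ev3_lincomb row ps : ev3 M (lincomb row ps) = dotr row [seq ev3 M p | p <- ps].
Proof.
elim: row ps => [|z row IH] [|p ps] //=.
by rewrite ev3D IH ev3_pt_mono /pt /= !expr0 !mulr1.
Qed.

Lemma ev3_dotprod_zipadd ps gs hs : ev3 M (dotprod ps (zipadd dadd gs hs)) =
  ev3 M (dotprod ps gs) + ev3 M (dotprod ps hs).
Proof.
elim: ps gs hs => [|p ps IH] [|g gs] [|h hs] //=; rewrite ?(addr0, add0r) //.
by rewrite !ev3D IH !ev3_pt_smul ev3D mulrDr addrACA.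
Qed.

Lemma ev3_dotprod_scale ps w row c :
  ev3 M (dotprod ps [seq dmono (Z.mul w x) (0, 0, 0)%N c | x <- row]) =
  zr w * dotr row [seq evs M p | p <- ps] * ev3 M c.
Proof.
elim: ps row => [|p ps IH] [|z row] //=; rewrite ?(mulr0, mul0r) //.
rewrite ev3D IH ev3_pt_smul ev3_pt_mono /pt /= !expr0 zrM; ring.
Qed.

Lemma ev3_block B : ev3 M (block_poly B) = evs M (common_factor B) *
  \sum_(r <- rows B) zr r.1 * dotr r.2 [seq evs M p | p <- left_basis B]
                            * dotr r.2 [seq evs M p | p <- right_basis B].
Proof.
rewrite /block_poly ev3_pt_smul; congr (_ * _).
rewrite /gram_mul; elim: (rows B) => [|r rs IH] /=.
  by rewrite big_nil; case: (left_basis B).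
rewrite ev3_dotprod_zipadd IH big_cons ev3_dotprod_scale ev3_lincomb -map_comp.
by congr (_ * dotr _ _ + _); apply: eq_map => p /=; rewrite ev3_dense_form.
Qed.

Lemma ev3_blocks Bs :
  ev3 M (blocks_poly Bs) = \sum_(B <- Bs) ev3 M (block_poly B).
Proof.
elim: Bs => [|B Bs IH] /=; first by rewrite big_nil.
by rewrite ev3D IH big_cons.
Qed.
End Point.
End Evaluation.

(** * Three-point bounds for seven unit vectors *)

(** Permuting the three points permutes u, v and t, so moments over distinct triples depend on the
    exponents only up to order; sorting makes equal moments coincide. *)
Definition sort12 (m : mono) : mono :=
  if (m.1.1 < m.1.2)%N then (m.1.2, m.1.1, m.2) else m.

Definition sort23 (m : mono) : mono :=
  if (m.1.2 < m.2)%N then (m.1.1, m.2, m.1.2) else m.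

#[local] Arguments Z.mul : simpl never.
#[local] Arguments smul : simpl never.

Definition sort3 (m : mono) : mono := sort12 (sort23 (sort12 m)).

(* Each monomial of [K] is summed over all triples, each monomial of [S] over the
   triples of distinct points. Both are written, up to the common factor 210, in
   terms of the moments of distinct triples, using that a sum over pairs is 1/5
   of the same sum over triples, and that there are 210 triples of distinct
   points. *)
Definition all_terms (t : Z * mono) : spoly :=
  let: (z, (a, b, c)) := t in
  [:: (Z.mul 210 z, sort3 (a, b, c)); (Z.mul 42 z, (b + c, 0, 0)%N);
      (Z.mul 42 z, (a + c, 0, 0)%N); (Z.mul 42 z, (a + b, 0, 0)%N);
      (Z.mul 7 z, (0, 0, 0)%N)].

Definition distinct_term (t : Z * mono) : Z * mono := (Z.mul 210 t.1, sort3 t.2).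

(** Minus [210 * L] times the excess of the pair sum over [e]: 42 is 210/5, and exponents double
    because [p] is a polynomial in the squares of the scalar products. *)
Definition target_terms (L e : Z) (p : seq (Z * nat)) : spoly :=
  (Z.mul L e, (0, 0, 0)%N) :: [seq (Z.mul (-42) (Z.mul L t.1), (t.2.*2, 0, 0)%N) | t <- p].

Lemma sort3_sym (T : Type) (f : nat -> nat -> nat -> T) :
  (forall a b c, f a b c = f b a c) -> (forall a b c, f a b c = f a c b) ->
  forall m, f (sort3 m).1.1 (sort3 m).1.2 (sort3 m).2 = f m.1.1 m.1.2 m.2.
Proof.
move=> s12 s23 m; pose F (m : mono) := f m.1.1 m.1.2 m.2.
have F12 n : F (sort12 n) = F n by rewrite /sort12; case: ifP => // _; exact: s12.
have F23 n : F (sort23 n) = F n by rewrite /sort23; case: ifP => // _; exact: s23.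
by rewrite -!/(F _) F12 F23 F12.
Qed.

(* [Q_k(u, v, t)] is the real part of [w_y ^+ k * (w_z ^+ k)^*], where [w_y] and
   [w_z] are the projections of the unit vectors [y] and [z] to the plane
   orthogonal to the pole [x], and [u = x.y], [v = x.z], [t = y.z]. *)
Fixpoint pole_kernels (k : nat) : dpoly * dpoly :=
  if k is k'.+1 then
    let: (p, q) := pole_kernels k' in
    (q, dadd (smul [:: (Zpos 2, (0, 0, 1)%N); (Zneg 2, (1, 1, 0)%N)] q)
         (smul [:: (Zneg 1, (0, 0, 0)%N); (Zpos 1, (2, 0, 0)%N);
                   (Zpos 1, (0, 2, 0)%N); (Zneg 1, (2, 2, 0)%N)] p))
  else (dense_form [:: (Zpos 1, (0, 0, 0)%N)],
        dense_form [:: (Zpos 1, (0, 0, 1)%N); (Zneg 1, (1, 1, 0)%N)]).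

Definition pole_block (k : nat) (ls : seq (seq (Z * nat))) (rs : seq (Z * seq Z)) :=
  Block [seq [seq (t.1, (t.2, 0, 0)%N) | t <- l] | l <- ls]
        [seq [seq (t.1, (0, t.2, 0)%N) | t <- l] | l <- ls]
        (terms (pole_kernels k).1) rs.

Definition square_block (ls : seq spoly) (rs : seq (Z * seq Z)) :=
  Block ls ls [:: (Zpos 1, (0, 0, 0)%N)] rs.

Definition pole_data := (nat * seq (seq (Z * nat)) * seq (Z * seq Z))%type.
Definition square_data := (seq spoly * seq (Z * seq Z))%type.

(** The zero test asserts that [L] times the excess of the pair sum over [e] equals the sum of the
    pole blocks over all triples plus that of the square blocks over distinct triples. *)
Definition certifies (L e : Z) (p : seq (Z * nat)) (Ks : seq pole_data)
    (Ss : seq square_data) : bool :=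
  let Bs := [seq pole_block K.1.1 K.1.2 K.2 | K <- Ks] in
  let Cs := [seq square_block s.1 s.2 | s <- Ss] in
  [&& Z.ltb Z0 L, all weights_ge0 Bs, all weights_ge0 Cs &
  dzero (dense_form (flatten [seq all_terms t | t <- terms (blocks_poly Bs)] ++
    [seq distinct_term t | t <- terms (blocks_poly Cs)] ++ target_terms L e p))].

Fixpoint upper_rows (w : Z) (n : nat) (rs : seq (seq Z)) : seq (Z * seq Z) :=
  if rs is r :: rs' then (w, ncons n Z0 r) :: upper_rows w n.+1 rs' else [::].

Definition diag_rows (ws : seq Z) : seq (Z * seq Z) :=
  [seq (nth Z0 ws i, ncons i Z0 [:: Zpos 1]) | i <- iota 0 (size ws)].

(** The two positions are given in increasing order. Each row supplies an off-diagonal entry of the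
    correction, together with diagonal weights that dominate it. *)
Definition pair_rows (ws : seq (Z * (nat * Z) * (nat * Z))) : seq (Z * seq Z) :=
  [seq (w.1.1, ncons w.1.2.1 Z0 (w.1.2.2 ::
          ncons (w.2.1 - w.1.2.1.+1) Z0 [:: w.2.2])) | w <- ws].

(* The Gram matrices of the certificates are sums of a rounded Cholesky
   factorization, the [rs], and of a diagonally dominant correction that makes the
   polynomial identity exact. *)
Definition cert_rows (w : Z) (rs : seq (seq Z)) ds ws :=
  upper_rows w 0 rs ++ diag_rows ds ++ pair_rows ws.

(** Exchanging y and z exchanges u and v and fixes t, so the squares can be taken of polynomials
    that are symmetric or antisymmetric in u and v; only half of each is stored. *)
Definition swap_sym (sgn : Z) (p : spoly) : spoly :=
  flatten [seq if t.2.1.1 == t.2.1.2 then [:: t] else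
    [:: t; (Z.mul sgn t.1, (t.2.1.2, t.2.1.1, t.2.2))] | t <- p].

(** * Moments of the Gram matrix over triples and pairs of points *)

Section Moments.
Variable R : realDomainType.
Variable d : 'I_7 -> 'I_7 -> R.
Hypothesis dC : forall i j, d i j = d j i.
Hypothesis d1 : forall i, d i i = 1.

Definition trip i j k : nat -> nat -> nat -> R := pt (d i j) (d i k) (d j k).

Definition Mall (a b c : nat) : R := \sum_i \sum_j \sum_k trip i j k a b c.

Definition Mdist (a b c : nat) : R :=
  \sum_i \sum_j \sum_(k | uniq [:: i; j; k]) trip i j k a b c.

Definition Mpair (a : nat) : R := \sum_i \sum_(j | j != i) d i j ^+ a.

Lemma uniq3C12 (i j k : 'I_7) : uniq [:: i; j; k] = uniq [:: j; i; k].
Proof. by rewrite /= !inE !andbT !negb_or eq_sym -!andbA; do 2!bool_congr; rewrite andbC. Qed.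

Lemma uniq3C23 (i j k : 'I_7) : uniq [:: i; j; k] = uniq [:: i; k; j].
Proof.
rewrite /= !inE !andbT !negb_or (eq_sym j k) -!andbA.
by case: (i == j); case: (i == k).
Qed.

Lemma MdistC12 a b c : Mdist a b c = Mdist b a c.
Proof.
apply: eq_bigr => i _; rewrite (exchange_big_dep xpredT) //=.
apply: eq_bigr => j _; apply: eq_big => [k|k _]; first by rewrite -[RHS]uniq3C23.
by rewrite /trip /pt (dC k j) [_ ^+ a * _]mulrC.
Qed.

Lemma MdistC23 a b c : Mdist a b c = Mdist a c b.
Proof.
rewrite /Mdist exchange_big /=.
apply: eq_bigr => i _; apply: eq_bigr => j _; apply: eq_big => [k|k _].
  exact: uniq3C12.
by rewrite /trip /pt (dC j i) mulrAC.
Qed.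

Lemma Mdist_sort3 m : Mdist (sort3 m).1.1 (sort3 m).1.2 (sort3 m).2 =
  Mdist m.1.1 m.1.2 m.2.
Proof. exact: sort3_sym MdistC12 MdistC23 m. Qed.

Lemma card_neq (i : 'I_7) : #|[pred j | j != i]| = 6%N.
Proof. by rewrite (@eq_card _ _ (predC1 i)) // cardC1 card_ord. Qed.

Lemma Mdist_pair a : Mdist a 0 0 = 5%:R * Mpair a.
Proof.
rewrite /Mdist /Mpair mulr_sumr; apply: eq_bigr => i _.
rewrite (bigD1 i) //= [X in X + _]big_pred0 ?add0r; last first.
  by move=> k; rewrite !inE eqxx.
rewrite mulr_sumr; apply: eq_bigr => j ji.
rewrite (eq_bigr (fun=> d i j ^+ a)); last first.
  by move=> k _; rewrite /trip /pt !expr0 !mulr1.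
rewrite sumr_const mulr_natl; congr (_ *+ _).
rewrite (@eq_card _ _ (mem (~: [set i; j])%SET)); last first.
  move=> k; rewrite 3!inE [LHS]unfold_in /= !inE !andbT.
  by rewrite (negb_or (i == j)) (eq_sym i j) ji /= (eq_sym i k) (eq_sym j k) negb_or.
by rewrite cardsCs finset.setCK cards2 card_ord eq_sym ji.
Qed.

Lemma Mpair0 : Mpair 0 = 42%:R.
Proof.
rewrite /Mpair (eq_bigr (fun=> 6%:R)) => [|i _].
  by rewrite sumr_const card_ord -mulrnA.
by rewrite (eq_bigr (fun=> 1)) // sumr_const card_neq.
Qed.

(** Triples are split by coincidences: [i = j] gives u = 1 and v = t, hence the exponent [b + c];
    [i = k] and [j = k] are similar; the 7 constant triples contribute 1 each. *)
Lemma Mall_dist a b c : Mall a b c =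
  Mdist a b c + Mpair (b + c) + Mpair (a + c) + Mpair (a + b) + 7%:R.
Proof.
have -> : 7%:R = \sum_(i : 'I_7) (1 : R) by rewrite sumr_const card_ord.
rewrite -!big_split; apply: eq_bigr => i _ /=.
have E j : j != i -> \sum_k trip i j k a b c =
    d i j ^+ (a + c) + d i j ^+ (a + b) + \sum_(k | uniq [:: i; j; k]) trip i j k a b c.
  move=> ji; rewrite (bigD1 i) //= (bigD1 j) //= addrA; congr (_ + _ + _).
  - by rewrite /trip /pt d1 expr1n mulr1 (dC j i) exprD.
  - by rewrite /trip /pt d1 expr1n mulr1 exprD.
  - apply: eq_bigl => k; rewrite !inE !andbT negb_or (eq_sym i j) ji.
    by rewrite (eq_sym i k) (eq_sym j k).
have Ei : \sum_k trip i i k a b c = 1 + \sum_(k | k != i) d i k ^+ (b + c).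
  rewrite (bigD1 i) //= {1}/trip /pt d1 !expr1n !mulr1; congr (_ + _).
  by apply: eq_bigr => k _; rewrite /trip /pt d1 expr1n mul1r exprD.
have -> : \sum_j \sum_(k | uniq [:: i; j; k]) trip i j k a b c =
    \sum_(j | j != i) \sum_(k | uniq [:: i; j; k]) trip i j k a b c.
  rewrite (bigD1 i) //= [X in X + _]big_pred0 ?add0r // => k.
  by rewrite !inE eqxx.
rewrite (bigD1 i) //= Ei (eq_bigr _ E) !big_split /=; ring.
Qed.

Lemma evs_sum (I : finType) (P : pred I) (M : I -> nat -> nat -> nat -> R) p :
  evs (fun a b c => \sum_(i | P i) M i a b c) p = \sum_(i | P i) evs (M i) p.
Proof. by rewrite /evs exchange_big /=; apply: eq_bigr => t _; rewrite mulr_sumr. Qed.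

Lemma evs_Mall p : evs Mall p = \sum_i \sum_j \sum_k evs (trip i j k) p.
Proof.
rewrite (evs_sum _ (fun i a b c => _)); apply: eq_bigr => i _.
rewrite (evs_sum _ (fun j a b c => _)); apply: eq_bigr => j _.
by rewrite (evs_sum _ (fun k a b c => _)).
Qed.

Lemma evs_Mdist p :
  evs Mdist p = \sum_i \sum_j \sum_(k | uniq [:: i; j; k]) evs (trip i j k) p.
Proof.
rewrite (evs_sum _ (fun i a b c => _)); apply: eq_bigr => i _.
rewrite (evs_sum _ (fun j a b c => _)); apply: eq_bigr => j _.
by rewrite (evs_sum _ (fun k a b c => _)).
Qed.

Lemma evs_flatten (T : Type) (g : T -> spoly) (M : nat -> nat -> nat -> R) s :
  evs M (flatten [seq g x | x <- s]) = \sum_(x <- s) evs M (g x).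
Proof.
elim: s => [|x s IH] /=; first by rewrite /evs !big_nil.
by rewrite evs_cat IH big_cons.
Qed.

Lemma zr_nat n : zr R (Z.of_nat n) = n%:R.
Proof. by rewrite /zr /int_of_Z; case: n => // n; rewrite /= SuccNat2Pos.id_succ. Qed.

Lemma all_terms_Mall t : evs Mdist (all_terms t) =
  210%:R * (zr R t.1 * Mall t.2.1.1 t.2.1.2 t.2.2).
Proof.
case: t => [z [[a b] c]]; rewrite /all_terms /evs.
rewrite !big_cons big_nil Mdist_sort3 /= !zrM !Mdist_pair Mpair0 Mall_dist.
have -> : zr R 210 = 210%:R by exact: (zr_nat 210).
have -> : zr R 42 = 42%:R by exact: (zr_nat 42).
have -> : zr R 7 = 7%:R by exact: (zr_nat 7).
ring.
Qed.

Lemma distinct_term_Mdist s : evs Mdist [seq distinct_term t | t <- s] =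
  210%:R * evs Mdist s.
Proof.
rewrite /evs big_map mulr_sumr; apply: eq_bigr => t _.
by rewrite /distinct_term /= Mdist_sort3 zrM mulrA (zr_nat 210).
Qed.

Lemma target_terms_Mdist L e p : evs Mdist (target_terms L e p) =
  210%:R * (zr R L * zr R e - zr R L * \sum_(t <- p) zr R t.1 * Mpair t.2.*2).
Proof.
rewrite /target_terms /evs big_cons big_map /= Mdist_pair Mpair0 zrM mulrBr.
congr (_ + _); first by ring.
rewrite !mulr_sumr -sumrN; apply: eq_bigr => t _.
rewrite Mdist_pair !zrM.
have -> : zr R (-42) = - 42%:R by rewrite -(zr_nat 42) /zr -mulrNz.
ring.
Qed.

Lemma zr_ge0 z : Z.leb Z0 z -> 0 <= zr R z.
Proof. by case: z => // n _; rewrite /zr /= ler0n. Qed.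

Lemma square_block_ge0 ls rs u v t : weights_ge0 (square_block ls rs) ->
  0 <= ev3 (pt (u : R) v t) (block_poly (square_block ls rs)).
Proof.
move=> w0; rewrite ev3_block /= {1}/evs big_seq1 /pt /= !expr0 !mulr1 mul1r.
move: w0; rewrite /weights_ge0 /=; elim: rs => [|r rs IH] /=.
  by rewrite big_nil.
move=> /andP[r0 /IH h]; rewrite big_cons addr_ge0 //.
by rewrite -mulrA mulr_ge0 ?zr_ge0 // -expr2 sqr_ge0.
Qed.

Section Pole.
Variables (i : 'I_7) (x y : 'I_7 -> R).
Hypothesis frame : forall j k, d j k = d i j * d i k + x j * x k + y j * y k.

(** Real and imaginary parts of the [n]-th power of the complex number with coordinates [x j] and
    [y j], the projection of point [j] to the plane orthogonal to the pole. *)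
Fixpoint turn (n : nat) (j : 'I_7) : R * R :=
  if n is n'.+1 then
    ((turn n' j).1 * x j - (turn n' j).2 * y j, (turn n' j).1 * y j + (turn n' j).2 * x j)
  else (1, 0).

Lemma frame1 j : x j ^+ 2 + y j ^+ 2 = 1 - d i j ^+ 2.
Proof. by rewrite -(d1 j) frame; ring. Qed.

(** For complex z, Re z^(n+2) = 2 Re z Re z^(n+1) - |z|^2 Re z^n. Here z is one projection times the
    conjugate of the other, so that Re z = t - uv and |z|^2 = (1 - u^2)(1 - v^2). The recurrence has
    order two, hence the two consecutive kernels. *)
Lemma ev_pole_kernels n j k :
  ev3 (trip i j k) (pole_kernels n).1 =
    (turn n j).1 * (turn n k).1 + (turn n j).2 * (turn n k).2 /\
  ev3 (trip i j k) (pole_kernels n).2 =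
    (turn n.+1 j).1 * (turn n.+1 k).1 + (turn n.+1 j).2 * (turn n.+1 k).2.
Proof.
have z2 : zr R (Zpos 2) = 2%:R by [].
have zm2 : zr R (Zneg 2) = - 2%:R by [].
have zm1 : zr R (Zneg 1) = - 1 by [].
elim: n => [|n [IH1 IH2]].
  split; rewrite ev3_dense_form /evs !big_cons big_nil /trip /pt /=; first by ring.
  by rewrite zm1 zr1 (frame j k); ring.
rewrite [pole_kernels _]/=; case: (pole_kernels n) IH1 IH2 => p q /= IH1 IH2.
split; first exact: IH2.
rewrite /trip ev3D !ev3_pt_smul -!/(trip i j k) IH1 IH2 /evs !big_cons !big_nil /= z2 zm2 zm1 zr1.
move: (turn n j).1 (turn n j).2 (turn n k).1 (turn n k).2 => a b a' b'.
transitivity (2%:R * (x j * x k + y j * y k) *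
    ((a * x j - b * y j) * (a' * x k - b' * y k) +
     (a * y j + b * x j) * (a' * y k + b' * x k)) -
  (1 - d i j ^+ 2) * (1 - d i k ^+ 2) * (a * a' + b * b')).
  by rewrite /trip /pt (frame j k); ring.
by rewrite -!frame1; ring.
Qed.

(** For each row, the double sum is the squared modulus of the sum over j of [f r j] times the n-th
    power of the projection of j. *)
Lemma pole_block_ge0 n ls rs : weights_ge0 (pole_block n ls rs) ->
  0 <= \sum_j \sum_k ev3 (trip i j k) (block_poly (pole_block n ls rs)).
Proof.
move=> w0.
pose f r j := dotr r [seq \sum_(t <- l) zr R t.1 * d i j ^+ t.2 | l <- ls].
have E j k : ev3 (trip i j k) (block_poly (pole_block n ls rs)) =
    \sum_(r <- rs) zr R r.1 * ((f r.2 j * (turn n j).1) * (f r.2 k * (turn n k).1) +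
                               (f r.2 j * (turn n j).2) * (f r.2 k * (turn n k).2)).
  rewrite ev3_block /= evs_terms (ev_pole_kernels n j k).1 mulr_sumr -!map_comp.
  apply: eq_bigr => r _; rewrite /f.
  set g := dotr _ _; set h := dotr _ _.
  have -> : g = f r.2 j.
    congr dotr; apply: eq_map => l /=; rewrite /evs big_map; apply: eq_bigr => t _.
    by rewrite /pt /= !expr0 !mulr1.
  have -> : h = f r.2 k.
    congr dotr; apply: eq_map => l /=; rewrite /evs big_map; apply: eq_bigr => t _.
    by rewrite /pt /= !expr0 mulr1 mul1r.
  by rewrite /f; ring.
under eq_bigr do under eq_bigr do rewrite E.
under eq_bigr do rewrite exchange_big; rewrite exchange_big /=.
move: w0; rewrite /weights_ge0 /=; elim: rs {E} => [|r rs' IH] /=.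
  by rewrite big_nil.
move=> /andP[r0 /IH h]; rewrite big_cons addr_ge0 //.
rewrite (_ : \sum_j _ = zr R r.1 * ((\sum_j f r.2 j * (turn n j).1) ^+ 2 +
                                    (\sum_j f r.2 j * (turn n j).2) ^+ 2)).
  by rewrite mulr_ge0 ?zr_ge0 // addr_ge0 ?sqr_ge0.
rewrite !expr2 !mulr_suml -big_split mulr_sumr; apply: eq_bigr => j _ /=.
by rewrite !mulr_sumr -big_split mulr_sumr.
Qed.
End Pole.

Hypothesis frames : forall i, exists x y, forall j k : 'I_7,
  d j k = d i j * d i k + x j * x k + y j * y k.

(** The zero polynomial is evaluated under [Mdist]. Its three parts become 210 times the pole sums
    over all triples, the square sums over distinct triples, and minus the scaled excess, which is
    therefore nonnegative. *)
Lemma certifies_sound L e p Ks Ss : certifies L e p Ks Ss ->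
  zr R e <= \sum_(t <- p) zr R t.1 * Mpair t.2.*2.
Proof.
case/and4P=> L0 wK wS /(dzeroP Mdist).
rewrite ev3_dense_form 2!evs_cat evs_flatten distinct_term_Mdist target_terms_Mdist.
rewrite (eq_bigr _ (fun t _ => all_terms_Mall t)) -mulr_sumr -mulrDr -mulrDr.
move=> /eqP; rewrite mulf_eq0 pnatr_eq0 /= => /eqP E.
have {}L0 : 0 < zr R L by move: L0; rewrite /zr; case: (L) => // q _; rewrite /= ltr0n;
  apply/ssrnat.ltP; exact: Pos2Nat.is_pos.
rewrite -(ler_pM2l L0) -subr_le0 -oppr_ge0.
have {}E : - (zr R L * zr R e - zr R L * \sum_(t <- p) zr R t.1 * Mpair t.2.*2) =
  evs Mall (terms (blocks_poly [seq pole_block K.1.1 K.1.2 K.2 | K <- Ks])) +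
  evs Mdist (terms (blocks_poly [seq square_block s.1 s.2 | s <- Ss])).
  by move/eqP: E; rewrite addrA addr_eq0 => /eqP <-.
rewrite E evs_Mall evs_Mdist addr_ge0 //.
  apply: sumr_ge0 => i _; have [x [y fr]] := frames i.
  under eq_bigr do under eq_bigr do rewrite evs_terms ev3_blocks big_map.
  under eq_bigr do rewrite exchange_big; rewrite exchange_big /=.
  elim: Ks wK {E} => [|K Ks' IH] /=; first by rewrite big_nil.
  case/andP=> wK /IH h; rewrite big_cons addr_ge0 //.
  exact: (pole_block_ge0 fr wK).
do 3 (apply: sumr_ge0 => ? _).
rewrite evs_terms ev3_blocks big_map.
elim: Ss wS {E} => [|s Ss' IH] /=; first by rewrite big_nil.
case/andP=> ws /IH h; rewrite big_cons addr_ge0 //.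
exact: square_block_ge0.
Qed.

End Moments.

(** * The certificates *)

Local Open Scope Z_scope.

(* The numerical suffixes are the order of the kernel and the degree of the
   certificate. As the bounds are sharp, the sum over the rhombic dodecahedron of
   [l(u) w ^+ k] has to vanish for every pole when [l] is in a pole basis of order
   [k] (a restriction on [l] for [k = 0, 3, 4] only), and square bases have to
   vanish at all its triples of distinct points. *)
Definition pole_basis_0_8 : seq (seq (Z * nat)) :=
  [:: [:: (-1, 0%N); (3, 2%N)]; [:: (-16, 0%N); (7, 2%N); (-84, 4%N); (189, 6%N)];
  [:: (-16, 0%N); (-7, 2%N); (98, 4%N); (-357, 6%N); (378, 8%N)]].

Definition pole_basis_1_8 : seq (seq (Z * nat)) :=
  [:: [:: (1, 1%N)]; [:: (1, 3%N)]; [:: (-1, 3%N); (9, 5%N)]; [:: (1, 3%N); (-12, 5%N); (27, 7%N)]].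

Definition pole_basis_2_8 : seq (seq (Z * nat)) :=
  [:: [:: (1, 0%N)]; [:: (1, 2%N)]; [:: (-1, 2%N); (9, 4%N)]; [:: (1, 2%N); (-12, 4%N); (27, 6%N)]].

Definition pole_basis_3_8 : seq (seq (Z * nat)) :=
  [:: [:: (-19, 1%N); (9, 3%N)]; [:: (-6, 1%N); (-1, 3%N); (9, 5%N)]].

Definition pole_basis_4_8 : seq (seq (Z * nat)) :=
  [:: [:: (8, 0%N); (3, 2%N)]; [:: (16, 0%N); (-3, 2%N); (27, 4%N)]].

Definition pole_basis_5_8 : seq (seq (Z * nat)) :=
  [:: [:: (1, 1%N)]; [:: (1, 3%N)]].

Definition square_basis_sym_8 : seq spoly := map (swap_sym (1))
  [:: [:: (1, (0, 0, 1)%N); (-12, (0, 0, 3)%N); (27, (0, 0, 5)%N)];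
 [:: (1, (0, 0, 3)%N); (-12, (0, 0, 5)%N); (27, (0, 0, 7)%N)];
 [:: (1, (2, 0, 1)%N); (-12, (2, 0, 3)%N); (27, (2, 0, 5)%N)];
 [:: (8, (0, 0, 1)%N); (-36, (0, 0, 3)%N); (-33, (2, 0, 1)%N); (81, (2, 0, 3)%N);
  (54, (4, 0, 1)%N)];
 [:: (4, (0, 0, 1)%N); (-24, (0, 0, 3)%N); (-9, (2, 0, 1)%N); (9, (2, 0, 3)%N); (162, (4, 0, 3)%N)];
 [:: (1, (2, 0, 1)%N); (-12, (4, 0, 1)%N); (27, (6, 0, 1)%N)];
 [:: (2, (0, 0, 3)%N); (-1, (2, 0, 1)%N); (-3, (2, 0, 3)%N); (6, (2, 2, 1)%N)];
 [:: (-2, (0, 0, 1)%N); (24, (0, 0, 3)%N); (3, (2, 0, 1)%N); (-63, (2, 0, 3)%N);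
  (162, (2, 2, 3)%N)];
 [:: (4, (0, 0, 1)%N); (-21, (2, 0, 1)%N); (27, (2, 0, 3)%N); (-36, (2, 2, 1)%N);
  (162, (4, 2, 1)%N)];
 [:: (-2, (0, 0, 1)%N); (6, (0, 0, 3)%N); (-4, (1, 1, 0)%N); (-2, (1, 1, 2)%N);
  (18, (1, 1, 4)%N); (3, (2, 0, 1)%N); (-9, (2, 0, 3)%N); (6, (3, 1, 0)%N)];
 [:: (2, (0, 0, 1)%N); (-6, (0, 0, 3)%N); (6, (1, 1, 0)%N); (-18, (1, 1, 2)%N);
  (-3, (2, 0, 1)%N); (9, (2, 0, 3)%N); (-9, (3, 1, 0)%N); (27, (3, 1, 2)%N)];
 [:: (2, (1, 1, 0)%N); (-12, (3, 1, 0)%N); (27, (5, 1, 0)%N)];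
 [:: (2, (0, 0, 1)%N); (-6, (0, 0, 3)%N); (6, (1, 1, 0)%N); (-3, (2, 0, 1)%N); (9, (2, 0, 3)%N);
  (-18, (3, 1, 0)%N); (54, (3, 3, 0)%N)]].

Definition square_basis_alt_8 : seq spoly := map (swap_sym (-1))
  [:: [:: (1, (2, 0, 1)%N); (-3, (2, 0, 3)%N)];
 [:: (2, (2, 0, 1)%N); (3, (2, 0, 3)%N); (-27, (2, 0, 5)%N)];
 [:: (-1, (2, 0, 1)%N); (3, (2, 0, 3)%N); (9, (4, 0, 1)%N); (-27, (4, 0, 3)%N)];
 [:: (-1, (2, 0, 1)%N); (12, (4, 0, 1)%N); (-27, (6, 0, 1)%N)];
 [:: (-3, (2, 0, 1)%N); (9, (4, 0, 1)%N); (-27, (4, 2, 1)%N)];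
 [:: (1, (3, 1, 0)%N); (-3, (3, 1, 2)%N)];
 [:: (4, (3, 1, 0)%N); (-9, (5, 1, 0)%N)]].

Definition pole_basis_0_10 : seq (seq (Z * nat)) :=
  [:: [:: (-1, 0%N); (3, 2%N)]; [:: (-16, 0%N); (7, 2%N); (-84, 4%N); (189, 6%N)];
  [:: (-16, 0%N); (-7, 2%N); (98, 4%N); (-357, 6%N); (378, 8%N)]; [:: (-16, 0%N); (-7, 4%N);
  (98, 6%N); (-357, 8%N); (378, 10%N)]].

Definition pole_basis_1_10 : seq (seq (Z * nat)) :=
  [:: [:: (1, 1%N)]; [:: (1, 3%N)]; [:: (-1, 3%N); (9, 5%N)]; [:: (1, 3%N); (-12, 5%N);
  (27, 7%N)]; [:: (-1, 3%N); (14, 5%N); (-51, 7%N); (54, 9%N)]].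

Definition pole_basis_2_10 : seq (seq (Z * nat)) :=
  [:: [:: (1, 0%N)]; [:: (1, 2%N)]; [:: (-1, 2%N); (9, 4%N)]; [:: (1, 2%N); (-12, 4%N);
  (27, 6%N)]; [:: (-1, 2%N); (14, 4%N); (-51, 6%N); (54, 8%N)]].

Definition pole_basis_3_10 : seq (seq (Z * nat)) :=
  [:: [:: (-19, 1%N); (9, 3%N)]; [:: (-6, 1%N); (-1, 3%N); (9, 5%N)]; [:: (1, 3%N); (-12, 5%N);
  (27, 7%N)]].

Definition pole_basis_4_10 : seq (seq (Z * nat)) :=
  [:: [:: (8, 0%N); (3, 2%N)]; [:: (16, 0%N); (-3, 2%N); (27, 4%N)]; [:: (1, 2%N); (-12, 4%N);
  (27, 6%N)]].

Definition pole_basis_5_10 : seq (seq (Z * nat)) :=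
  [:: [:: (1, 1%N)]; [:: (1, 3%N)]; [:: (-1, 3%N); (9, 5%N)]].

Definition square_basis_sym_10 : seq spoly := map (swap_sym (1))
  [:: [:: (1, (0, 0, 1)%N); (-12, (0, 0, 3)%N); (27, (0, 0, 5)%N)];
 [:: (1, (0, 0, 3)%N); (-12, (0, 0, 5)%N); (27, (0, 0, 7)%N)];
 [:: (-1, (0, 0, 3)%N); (14, (0, 0, 5)%N); (-51, (0, 0, 7)%N); (54, (0, 0, 9)%N)];
 [:: (1, (2, 0, 1)%N); (-12, (2, 0, 3)%N); (27, (2, 0, 5)%N)];
 [:: (1, (2, 0, 3)%N); (-12, (2, 0, 5)%N); (27, (2, 0, 7)%N)];
 [:: (8, (0, 0, 1)%N); (-36, (0, 0, 3)%N); (-33, (2, 0, 1)%N); (81, (2, 0, 3)%N);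
  (54, (4, 0, 1)%N)];
 [:: (4, (0, 0, 1)%N); (-24, (0, 0, 3)%N); (-9, (2, 0, 1)%N); (9, (2, 0, 3)%N); (162, (4, 0, 3)%N)];
 [:: (2, (0, 0, 1)%N); (-18, (0, 0, 3)%N); (9, (2, 0, 3)%N); (-81, (2, 0, 5)%N);
  (-81, (4, 0, 3)%N); (729, (4, 0, 5)%N)];
 [:: (1, (2, 0, 1)%N); (-12, (4, 0, 1)%N); (27, (6, 0, 1)%N)];
 [:: (1, (2, 0, 3)%N); (-12, (4, 0, 3)%N); (27, (6, 0, 3)%N)];
 [:: (-1, (2, 0, 1)%N); (14, (4, 0, 1)%N); (-51, (6, 0, 1)%N); (54, (8, 0, 1)%N)];
 [:: (2, (0, 0, 3)%N); (-1, (2, 0, 1)%N); (-3, (2, 0, 3)%N); (6, (2, 2, 1)%N)];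
 [:: (-2, (0, 0, 1)%N); (24, (0, 0, 3)%N); (3, (2, 0, 1)%N); (-63, (2, 0, 3)%N);
  (162, (2, 2, 3)%N)];
 [:: (-1, (0, 0, 1)%N); (9, (0, 0, 3)%N); (3, (2, 0, 1)%N); (-27, (2, 0, 3)%N);
  (-27, (2, 2, 3)%N); (243, (2, 2, 5)%N)];
 [:: (4, (0, 0, 1)%N); (-21, (2, 0, 1)%N); (27, (2, 0, 3)%N); (-36, (2, 2, 1)%N);
  (162, (4, 2, 1)%N)];
 [:: (4, (0, 0, 3)%N); (-1, (2, 0, 1)%N); (-9, (2, 0, 3)%N); (-36, (2, 2, 3)%N);
  (162, (4, 2, 3)%N)];
 [:: (2, (2, 2, 1)%N); (-12, (4, 2, 1)%N); (27, (6, 2, 1)%N)];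
 [:: (2, (0, 0, 1)%N); (-6, (0, 0, 3)%N); (-9, (2, 0, 1)%N); (27, (2, 0, 3)%N); (6, (2, 2, 1)%N);
  (-54, (4, 2, 1)%N); (486, (4, 4, 1)%N)];
 [:: (-2, (0, 0, 1)%N); (6, (0, 0, 3)%N); (-4, (1, 1, 0)%N); (-2, (1, 1, 2)%N);
  (18, (1, 1, 4)%N); (3, (2, 0, 1)%N); (-9, (2, 0, 3)%N); (6, (3, 1, 0)%N)];
 [:: (1, (1, 1, 2)%N); (-12, (1, 1, 4)%N); (27, (1, 1, 6)%N)];
 [:: (2, (0, 0, 1)%N); (-6, (0, 0, 3)%N); (6, (1, 1, 0)%N); (-18, (1, 1, 2)%N);
  (-3, (2, 0, 1)%N); (9, (2, 0, 3)%N); (-9, (3, 1, 0)%N); (27, (3, 1, 2)%N)];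
 [:: (-4, (0, 0, 1)%N); (12, (0, 0, 3)%N); (-8, (1, 1, 0)%N); (6, (2, 0, 1)%N);
  (-18, (2, 0, 3)%N); (12, (3, 1, 0)%N); (-9, (3, 1, 2)%N); (81, (3, 1, 4)%N)];
 [:: (2, (1, 1, 0)%N); (-12, (3, 1, 0)%N); (27, (5, 1, 0)%N)];
 [:: (2, (0, 0, 1)%N); (-6, (0, 0, 3)%N); (6, (1, 1, 0)%N); (-12, (1, 1, 2)%N);
  (-3, (2, 0, 1)%N); (9, (2, 0, 3)%N); (-9, (3, 1, 0)%N); (-9, (3, 1, 2)%N); (81, (5, 1, 2)%N)];
 [:: (1, (3, 1, 0)%N); (-12, (5, 1, 0)%N); (27, (7, 1, 0)%N)];
 [:: (2, (0, 0, 1)%N); (-6, (0, 0, 3)%N); (6, (1, 1, 0)%N); (-3, (2, 0, 1)%N); (9, (2, 0, 3)%N);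
  (-18, (3, 1, 0)%N); (54, (3, 3, 0)%N)];
 [:: (14, (0, 0, 1)%N); (-42, (0, 0, 3)%N); (36, (1, 1, 0)%N); (-54, (1, 1, 2)%N);
  (-21, (2, 0, 1)%N); (63, (2, 0, 3)%N); (-54, (3, 1, 0)%N); (486, (3, 3, 2)%N)];
 [:: (2, (0, 0, 1)%N); (-6, (0, 0, 3)%N); (6, (1, 1, 0)%N); (-3, (2, 0, 1)%N); (9, (2, 0, 3)%N);
  (-15, (3, 1, 0)%N); (-18, (3, 3, 0)%N); (81, (5, 3, 0)%N)]].

Definition square_basis_alt_10 : seq spoly := map (swap_sym (-1))
  [:: [:: (1, (2, 0, 1)%N); (-3, (2, 0, 3)%N)];
 [:: (2, (2, 0, 1)%N); (3, (2, 0, 3)%N); (-27, (2, 0, 5)%N)];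
 [:: (-1, (2, 0, 3)%N); (12, (2, 0, 5)%N); (-27, (2, 0, 7)%N)];
 [:: (-1, (2, 0, 1)%N); (3, (2, 0, 3)%N); (9, (4, 0, 1)%N); (-27, (4, 0, 3)%N)];
 [:: (-2, (2, 0, 1)%N); (-3, (2, 0, 3)%N); (27, (2, 0, 5)%N); (18, (4, 0, 1)%N);
  (27, (4, 0, 3)%N); (-243, (4, 0, 5)%N)];
 [:: (-1, (2, 0, 1)%N); (12, (4, 0, 1)%N); (-27, (6, 0, 1)%N)];
 [:: (-1, (2, 0, 3)%N); (12, (4, 0, 3)%N); (-27, (6, 0, 3)%N)];
 [:: (1, (2, 0, 1)%N); (-14, (4, 0, 1)%N); (51, (6, 0, 1)%N); (-54, (8, 0, 1)%N)];
 [:: (-3, (2, 0, 1)%N); (9, (4, 0, 1)%N); (-27, (4, 2, 1)%N)];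
 [:: (-3, (2, 0, 1)%N); (9, (4, 0, 1)%N); (-81, (4, 2, 3)%N)];
 [:: (12, (4, 2, 1)%N); (-27, (6, 2, 1)%N)];
 [:: (1, (3, 1, 0)%N); (-3, (3, 1, 2)%N)];
 [:: (2, (3, 1, 0)%N); (3, (3, 1, 2)%N); (-27, (3, 1, 4)%N)];
 [:: (4, (3, 1, 0)%N); (-9, (5, 1, 0)%N)];
 [:: (1, (3, 1, 0)%N); (1, (3, 1, 2)%N); (-9, (5, 1, 2)%N)];
 [:: (-1, (3, 1, 0)%N); (12, (5, 1, 0)%N); (-27, (7, 1, 0)%N)];
 [:: (1, (3, 1, 0)%N); (-27, (5, 3, 0)%N)]].

(* 729000 (t(t-1/9) - t(t-1/9)^2(t-1/3)^2/100 - t/1000): the weights 1/100 and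
   1/1000 are small enough for the rhombic dodecahedron to remain optimal. *)
Definition cert2_scale : Z := 620695790494584416904413184.
Definition cert2_target : seq (Z * nat) := [:: (-81739, 1%N); (729240, 2%N); (-1980, 3%N);
  (6480, 4%N); (-7290, 5%N)].
Definition cert2_poles : seq pole_data := [::
 (0%N, pole_basis_0_8, (cert_rows 1607557576017456000
 [:: [:: 2237892; -157107; 111021];
 [:: 12777; -13004];
 [:: 4687]]
 [:: 2243848734413406613699820544; 8599427683285869758264988; 10101125933579599633196064]
 [:: (1501698250293729874931076, (0%N, 16), (1%N, -1));
 (165431211740713923795936, (1%N, 1), (2%N, 1))]));
 (1%N, pole_basis_1_8, (cert_rows 1607557576017456000
 [:: [:: 9554586; 1507199; -3803263; 1330356];
 [:: 9888497; -1000977; -237387];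
 [:: 990656; -1234173];
 [:: 178780]]
 [:: 133107812360192089236199223232; 140463560684655363266176514176;
  9164813580074524616769955108; 2023525561148301572447728020]
 [:: (1960345804651063250688303624, (0%N, 1), (1%N, -1));
 (173795095058202671785598475, (0%N, 4), (2%N, -1));
 (3139745333985607214739816, (0%N, 8), (3%N, 1));
 (879957213415851162832857337, (1%N, 4), (2%N, -1));
 (127444948122078313451074518, (1%N, 8), (3%N, -1));
 (37024180867940529919727526, (2%N, 2), (3%N, -1))]));
 (2%N, pole_basis_2_8, (cert_rows 1607557576017456000
 [:: [:: 2562697; 7444464; -2340448; 682515];
 [:: 9825406; -51743; -288332];
 [:: 1516636; -783905];
 [:: 204666]]
 [:: 752833930758736745974762213248; 762991797216030145383922701952;
  47101670482397806502676590848; 11785995803313992711950318638]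
 [:: (2721926521286139296824117248, (0%N, 1), (1%N, 1));
 (49303299287224068304806336, (0%N, 4), (2%N, 1));
 (27975516013804976083008612, (0%N, 8), (3%N, -1));
 (332525103182579356014819280, (1%N, 4), (2%N, -1));
 (57863384775677032808506194, (1%N, 8), (3%N, 1));
 (71548423183866640117159788, (2%N, 2), (3%N, -1))]));
 (3%N, pole_basis_3_8, (cert_rows 1607557576017456000
 [:: [:: 584495; -2147328];
 [:: 732115]]
 [:: 30644088055847569350331847451; 122681301873934092726077309340]
 [:: (110503135276255420574077377, (0%N, 1), (1%N, -2))]));
 (4%N, pole_basis_4_8, (cert_rows 1607557576017456000
 [:: [:: 1349028; -635659];
 [:: 15498]]
 [:: 502416499731927471114374160; 143427896321900447260596348]
 [:: (9052500230012716916422452, (0%N, 2), (1%N, -1))]));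
 (5%N, pole_basis_5_8, (cert_rows 1607557576017456000
 [:: [:: 1943316; -8892144];
 [:: 317605]]
 [:: 4685618035657689818430472506; 6448916426221404793794789198]
 [:: (80717705058006801443048922, (0%N, 1), (1%N, -1))]))].
Definition cert2_squares : seq square_data := [::
 (square_basis_sym_8, (cert_rows 1607557576017456000
 [:: [:: 674366; -648889; 444709; -158172; -148316; 691653; -4052937; 9346; -97316; 526399;
  1157255; 245861; 326178];
 [:: 120257; -165610; -19245; -115269; 51355; -3971113; 460; 113592; 251918; 186707; -84660;
  -32335];
 [:: 251618; 2482; -36856; 73488; -523191; 9142; -27581; -166627; 55963; 113712; 84124];
 [:: 84361; -5213; -162221; 183587; 125158; -18210; -156525; -161404; 13170; -17964];
 [:: 60124; -52205; 1596475; -7065; -41812; -170313; -107502; 66537; 29350];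
 [:: 66259; 246487; -9817; -12074; 9110; 1056; -25505; 41174];
 [:: 503222; -37830; -8072; 16412; 52180; 29517; 26840];
 [:: 25404; -6030; -22879; 301; 20774; -3369];
 [:: 21445; -116926; -98310; -18957; -36136];
 [:: 84173; 73579; -10600; 21925];
 [:: 52396; 11769; -22341];
 [:: 32626; 37601];
 [:: 44158]]
 [:: 72437933305092246441984000; 72345549613654451297905056; 18109586209957926727680000;
  4527293668804616564736000; 4527293668804616564736000; 18109586209957926727680000;
  289752556289847906705408000; 4527293668804616564736000; 4357842695767595590692948;
  15909619892916864739409064; 18109586209957926727680000; 17431782317809842831507792;
  18109586209957926727680000]
 [:: (2199966317041061988270936, (1%N, 2), (9%N, -1));
 (169450973037020974043052, (8%N, 1), (11%N, 2))]));
 (square_basis_alt_8, (cert_rows 1607557576017456000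
 [:: [:: 4449749; -338742; -509466; 136304; 692530; 1207031; -46966];
 [:: 92126; -97147; 48258; 168654; -501089; -131886];
 [:: 222120; 245575; 617789; -3320946; -555954];
 [:: 125120; 292484; -1255290; -317326];
 [:: 123205; 42675; 38219];
 [:: 1169409; 94038];
 [:: 66247]]
 [:: 3190672471334615265359296656; 1413533679097918919818004532; 246679194170912400721280394;
  365026402857018414519114660; 382148975999803036544352000; 4629220832484897658395655248;
  1107375752906714398204598508]
 [:: (59449294409210505310080276, (0%N, 2), (1%N, -1));
 (97518855012027536200581468, (0%N, 4), (2%N, 1));
 (240931497965016194681081688, (0%N, 2), (6%N, 1));
 (15831203108784878846139192, (1%N, 1), (5%N, -2));
 (47619609186298881031242138, (2%N, 1), (5%N, -4));
 (895483517490219794976000, (3%N, 1), (4%N, -1));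
 (3324238062977640725110404, (3%N, 1), (5%N, -4));
 (2325267392303742596190936, (3%N, 1), (6%N, 2));
 (111212530028875280662848828, (5%N, 2), (6%N, -1))]))].
(** The bound 729000 (16/9 - 28/3000) is the value at the rhombic dodecahedron, where t(t-1/9) sums
    to 16/9 over ordered pairs, t sums to 28/3 and the quintic term vanishes. *)
Lemma cert2_certified : certifies cert2_scale (1289196) cert2_target cert2_poles cert2_squares.
Proof. by vm_compute. Qed.

(* 81 t(t-1/9)^2 *)
Definition cert3_scale : Z := 214271111838378712104960.
Definition cert3_target : seq (Z * nat) := [:: (1, 1%N); (-18, 2%N); (81, 3%N)].
Definition cert3_poles : seq pole_data := [::
 (0%N, pole_basis_0_8, (cert_rows 15785153717760
 [:: [:: 77279; -4665; 2972];
 [:: 5844; -7097];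
 [:: 1624]]
 [:: 2454307886348325038080; 9565515779946004330; 9592130904156382320]
 [:: (26615124210377990, (0%N, 16), (1%N, -1));
 (21627545800732560, (1%N, 1), (2%N, -1))]));
 (1%N, pole_basis_1_8, (cert_rows 15785153717760
 [:: [:: 429971; -509573; 9183; 20371];
 [:: 473394; -261130; 49805];
 [:: 164720; -140939];
 [:: 64575]]
 [:: 79322701524902313476600; 55856012418855997564440; 4006246272388291423590;
  1159885999292136896640]
 [:: (2594011849599784286820, (0%N, 1), (1%N, 1));
 (150949921413918299925, (0%N, 4), (2%N, -1));
 (63353649779376914475, (0%N, 8), (3%N, -1));
 (620430242470628027585, (1%N, 4), (2%N, 1));
 (146866289448597381985, (1%N, 8), (3%N, 1));
 (23557933527944527040, (2%N, 2), (3%N, -1))]));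
 (2%N, pole_basis_2_8, (cert_rows 15785153717760
 [:: [:: 99753; 879; 33247; -54407];
 [:: 464476; -81623; 60561];
 [:: 92813; -126773];
 [:: 31054]]
 [:: 60971560277230340265920; 59489890612382447707840; 3581048601702225070200;
  927729667344472495720]
 [:: (54906976008214706880, (0%N, 1), (1%N, 1));
 (1817515198161390840, (0%N, 4), (2%N, -1));
 (7594945806076614720, (0%N, 8), (3%N, -1));
 (43785255942872642800, (1%N, 4), (2%N, 1));
 (17423876450309362600, (1%N, 8), (3%N, -1));
 (22415682102919838320, (2%N, 2), (3%N, -1))]));
 (3%N, pole_basis_3_8, (cert_rows 15785153717760
 [:: [:: 108858; -313889];
 [:: 30704]]
 [:: 797025549019429608165; 3248167830494431557510]
 [:: (4599874762084702485, (0%N, 1), (1%N, -2))]));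
 (4%N, pole_basis_4_8, (cert_rows 15785153717760
 [:: [:: 90930; -48698];
 [:: 2255]]
 [:: 99657342290403555840; 24914339518889318400]
 [::]));
 (5%N, pole_basis_5_8, (cert_rows 15785153717760
 [:: [:: 75134; -394586];
 [:: 162148]]
 [:: 8280314249519020693320; 7766308316042135317080]
 [:: (80002324283413141890, (0%N, 1), (1%N, 1))]))].
Definition cert3_squares : seq square_data := [::
 (square_basis_sym_8, (cert_rows 15785153717760
 [:: [:: 30853; -25754; -13951; -7075; 2260; -1309; -218976; 10253; 2774; -1473; 2686; 2248;
  -16034];
 [:: 24028; -32317; -2274; -1246; 6895; -113793; 3164; -892; 25868; 17611; -2616; 11546];
 [:: 15860; 624; -3398; 3852; -43479; -527; 1773; -10269; -2437; 4062; -3857];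
 [:: 12485; 2072; -10718; 213969; 7728; -9979; -18031; -17026; 2201; 23061];
 [:: 6827; -10663; 128650; -896; -3321; -20145; -14699; 3039; 2289];
 [:: 17156; 59517; -1054; -5616; 18301; 11803; -77; 17070];
 [:: 134321; -10240; -1798; 9118; 17650; 7125; 5512];
 [:: 5151; -2321; 5599; 6375; 3412; 1332];
 [:: 4922; -24569; -16274; -3974; -13284];
 [:: 12325; 2296; -6532; -2255];
 [:: 13966; 1365; -15057];
 [:: 6995; -7202];
 [:: 5158]]
 [:: 14766111549202567680; 7824687563526267168; 3691531833589071360; 922879012108838400;
  922879012108838400; 3691531833589071360; 59064430411656552960; 922879012108838400;
  922879012108838400; 2076055524382936320; 3691531833589071360; 3691531833589071360;
  3691531833589071360]
 [:: (1615476309206135040, (1%N, 2), (9%N, 1))]));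
 (square_basis_alt_8, (cert_rows 15785153717760
 [:: [:: 256816; -29533; -7231; 4006; 12768; -23997; 331];
 [:: 25406; -46490; 4377; 14357; 124556; -2087];
 [:: 27596; -2193; 4894; -206249; -6102];
 [:: 13759; 18278; -135016; -34672];
 [:: 28012; -33218; 1317];
 [:: 232044; 14239];
 [:: 23390]]
 [:: 335669236774779485340; 951642436952190461940; 213893123918453491365; 271049599615876391205;
  244339961944826988450; 789340402681190185140; 220628730638957979870]
 [:: (156386626951124985660, (0%N, 2), (1%N, 1));
 (17572405594874414445, (0%N, 4), (2%N, -1));
 (3438793864613642535, (0%N, 4), (3%N, -1));
 (31173937408265156190, (0%N, 4), (4%N, 1));
 (996826258278980323740, (0%N, 1), (5%N, 1));
 (427547141000057063790, (0%N, 2), (6%N, -1));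
 (1370667990083080500, (1%N, 2), (3%N, 1));
 (5898501530330250240, (1%N, 1), (5%N, -2));
 (48044697206489538030, (2%N, 1), (5%N, -4));
 (2487771796226411520, (3%N, 1), (4%N, -1));
 (1803252551544178560, (3%N, 1), (5%N, 4));
 (2127120496659889920, (3%N, 1), (6%N, -2));
 (473966223383127110580, (5%N, 2), (6%N, 1))]))].
(** At the rhombic dodecahedron only the 24 ordered pairs with t = 1/3 contribute, which gives 81 *
    24 * 1/3 * (2/9)^2 = 32. *)
Lemma cert3_certified : certifies cert3_scale (32) cert3_target cert3_poles cert3_squares.
Proof. by vm_compute. Qed.

(* 2430000 (t(t-1/9)^2(t-1/3) - t/10000) *)
Definition cert4_scale : Z := 69141050381328469063737120957080272896.
Definition cert4_target : seq (Z * nat) := [:: (-10243, 1%N); (210000, 2%N); (-1350000, 3%N);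
  (2430000, 4%N)].
Definition cert4_poles : seq pole_data := [::
 (0%N, pole_basis_0_10, (cert_rows 37306325234937749396575680000
 [:: [:: 489180; -116188; -687306; 851718];
 [:: 129908; 317695; -495382];
 [:: 322077; -345656];
 [:: 73272]]
 [:: 1644960445158824968601496825809876386816; 6566556858791941768951909373704564375;
  6548930201130998963697977886810031875; 6492980385706976168164789886115761250]
 [:: (42481737658637428028035440737155625, (0%N, 16), (1%N, 1));
 (57500312780990695273449799740088125, (0%N, 16), (2%N, 1));
 (73808582209002224560495269051918750, (0%N, 16), (3%N, 1));
 (21091664003673382114674032872200000, (1%N, 1), (3%N, 1));
 (23699746542262920123191160763800000, (2%N, 1), (3%N, -1))]));
 (1%N, pole_basis_1_10, (cert_rows 37306325234937749396575680000
 [:: [:: 7902165; -13440217; 3027091; -340334; -6077951];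
 [:: 7219761; -2961383; 3410988; -3642328];
 [:: 988631; 2225183; -5495664];
 [:: 1995077; 381079];
 [:: 3568147]]
 [:: 7073312329110406540321830558917291041792; 7094035460720984260587102929629337280000;
  448953280198900944970401755017688520000; 112335087471977725051476493408665600000;
  28083733666317390686613741258670080000]
 [:: (89217022461430858939325150653679040000, (0%N, 1), (1%N, 1));
 (386764075593630625461161869003320000, (1%N, 4), (2%N, 1))]));
 (2%N, pole_basis_2_10, (cert_rows 37306325234937749396575680000
 [:: [:: 1983721; -4683915; 2839154; -4548014; -4771216];
 [:: 9581271; -1677857; 25212; -3589306];
 [:: 2610264; -1306559; -3275295];
 [:: 1521904; 1543189];
 [:: 1942924]]
 [:: 13263079069354910748609107434418313720448; 13149412617370062225479006301645636720000;
  778503958049100449321950584174656250000; 200639133486866548179421247568913380000;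
  48489078381273102717341218958586457500]
 [:: (32399904705844219983477608802770160000, (0%N, 1), (1%N, 1));
 (23270677327474689388154383450050000, (0%N, 4), (2%N, 1));
 (495983819462501495667968357767447500, (0%N, 8), (3%N, -1));
 (289548859820129331820839609984348750, (0%N, 16), (4%N, -1));
 (5304891009626131758147529751776500000, (1%N, 4), (2%N, 1));
 (260662100742188568212556952109452500, (1%N, 8), (3%N, -1));
 (507671272541294663779551920577603750, (1%N, 16), (4%N, 1));
 (4324279071569363500696220241811800000, (2%N, 2), (3%N, 1));
 (2143754307702664299313269884498430000, (2%N, 4), (4%N, 1));
 (973632482551855375707222512261640000, (3%N, 2), (4%N, 1))]));
 (3%N, pole_basis_3_10, (cert_rows 37306325234937749396575680000
 [:: [:: 2429662; -6812435; -5780258];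
 [:: 540484; 2152743];
 [:: 4497852]]
 [:: 520356677167256745950929717449565815000; 2090907207110523756425382854964126000000;
  520156434833273896640031651291197550000]
 [:: (2364266041854677164491521288422095000, (0%N, 1), (1%N, -2));
 (1106772560947836444164389465881330000, (0%N, 1), (2%N, -1));
 (1510097592439021202282627065369440000, (1%N, 2), (2%N, 1))]));
 (4%N, pole_basis_4_10, (cert_rows 37306325234937749396575680000
 [:: [:: 1820206; -1010424; -1262623];
 [:: 20828; -285922];
 [:: 3175797]]
 [:: 19086163925521959753804992035146240000; 4788962233806639374699240698675200000;
  4788962233806639374699240698675200000]
 [::]));
 (5%N, pole_basis_5_10, (cert_rows 37306325234937749396575680000
 [:: [:: 3514048; -21567097; 1629701];
 [:: 13896452; -6654740];
 [:: 446603]]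
 [:: 766141109322074437576019584393386000000; 766242056164594902118019515609251840000;
  47890080758190880662056992108707840000]
 [::]))].
Definition cert4_squares : seq square_data := [::
 (square_basis_sym_10, (cert_rows 37306325234937749396575680000
 [:: [:: 1881124; -2308676; 430767; -1449630; 1289612; -734585; 95891; -32985; 1634854; 719955;
  -758974; -11331020; 59045; 37534; 453255; 674661; -3381879; 309948; 355904; 419301; 4961381;
  -417376; 151086; -741096; 427598; 668357; -686691; -269439];
 [:: 2118911; -1896607; -1976900; 176711; 186147; -492143; 146814; -216251; -493434; 448520;
  -2733000; -2140; 83347; 222611; -232180; 107358; -105299; -1109046; -688216; 400864; 496082;
  -85574; 121985; -283611; -232414; -111202; 242332];
 [:: 1195815; -542240; -2530339; -151792; 301961; 53648; 423401; -1251009; -302358; 779508;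
  184089; 589446; -120014; -810696; 646216; 377850; -144584; 390437; -331364; -82184; 217640;
  113363; 301131; 845708; -3516; -671480];
 [:: 1795049; -472696; -115721; -80654; -80014; 156750; 1100537; -64541; -2495115; -12835;
  -769546; 142574; 752222; -1437821; -165330; -2347926; 867691; 371686; 818028; 159906; -259050;
  -267822; -262920; -95222; 250339];
 [:: 1371091; 100781; -25776; -98371; -348281; 796438; 473514; 2007905; -212810; -129083; -31342;
  125266; -917940; -186843; -1517540; -115665; -1003324; 690204; -516176; 316449; -230369;
  -813740; 75353; 669115];
 [:: 410957; -387758; 47407; -631920; 948329; 131399; 1047968; 11153; -293038; -31483; 283787;
  205103; -272546; 1253858; 335764; -1006416; -316513; -400369; 159287; -92538; -1053388; 214588;
  499868];
 [:: 375792; -127253; -550319; 1141863; -80643; 3225065; -107084; 628480; -218785; -243112;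
  555914; 122067; 1000586; 245428; 82350; -364099; 6942; -92775; 118930; 18951; 37589; -36712];
 [:: 148387; 314616; -2853073; 160052; 1293166; 379275; -580723; -187501; -161952; 1472826;
  137296; -345794; -356788; -220672; 66312; 105889; -94063; 99110; 220504; 35107; -187610];
 [:: 1520548; -2794821; 13655; 2578245; -177308; -46754; -233730; 259929; -2044337; 191061;
  -765957; 124846; -346536; 290497; -231196; 355949; 190883; 258310; -42546; -75666];
 [:: 3212071; -561141; -1775248; 175956; 164254; -50277; -37476; -2362607; 209246; 2121617;
  -537179; 1027343; -813185; 228345; -585230; 24297; -61644; 14035; 86422];
 [:: 839330; 860781; 113612; -266824; -49400; -401633; -1672004; 96844; -3199470; 509178;
  -1224224; 1180639; -342042; 251669; -226308; -484112; 40961; 376313];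
 [:: 5208998; -768359; 72430; -160595; 1193135; -328764; -330687; 2575485; -392460; 1539062;
  -938387; -613948; -333927; 517420; -222576; -127651; 570554];
 [:: 467151; -284338; -223162; -1017830; -20743; 743911; -4591018; 562117; -1160168; 1615692;
  1046635; 269785; -378556; 1075416; -49523; -1119361];
 [:: 368121; -158398; -136870; 600709; 450878; 1162535; -602513; 1329865; -550882; 656020;
  -171827; 234380; 1101348; -178641; -952133];
 [:: 152235; -326222; -290762; -121745; -931449; -173614; -1517414; 391509; -211640; 348410;
  -51601; -309855; 165892; 107338];
 [:: 244741; 446971; -100987; 947891; -114149; 225709; -323970; 380633; -169034; -158845; 247267;
  31003; -144686];
 [:: 2192770; 37011; 123946; -10215; 431444; -60227; 819804; -336897; -425926; 554035; -16829;
  -566560];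
 [:: 120860; -634011; 177919; -38689; 75388; 52929; -71461; 362256; 267281; -57767; -316021];
 [:: 2310710; 442604; -84053; -729491; -59010; 254728; -21963; 80828; 95801; -90328];
 [:: 1076390; 191028; -29513; -54126; -177129; 84377; -73805; -10527; 76503];
 [:: 908407; 33812; -160012; 2443; -122491; -17194; -146460; 254897];
 [:: 89275; 612280; -187848; -463791; 123235; 52159; -157360];
 [:: 538717; -266243; -95770; -45196; 70282; -87277];
 [:: 405980; 26272; 457454; -81043; -272865];
 [:: 743657; 228795; 1952; -256113];
 [:: 327385; -17649; -46071];
 [:: 29445; -88902];
 [:: 59236]]
 [:: 19776493684725818680441621737062208000; 19251845410924541939898961233071040000;
  4435020842629153798407147398663040000; 5020770010088856092357784034344960000;
  5020770010088856092357784034344960000; 1255154300845173446834063915089920000;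
  1255154300845173446834063915089920000; 302600683900423380458105276345580000;
  5020770010088856092357784034344960000; 5020770010088856092357784034344960000;
  5020770010088856092357784034344960000; 80332472968129859782746072923504640000;
  1255154300845173446834063915089920000; 1255154300845173446834063915089920000;
  1255154300845173446834063915089920000; 1255154300845173446834063915089920000;
  5020770010088856092357784034344960000; 1108717008980247873346404756169440000;
  5020770010088856092357784034344960000; 20083080040355424369431136137379840000;
  5020770010088856092357784034344960000; 1255154300845173446834063915089920000;
  5020770010088856092357784034344960000; 5020770010088856092357784034344960000;
  5020770010088856092357784034344960000; 5020770010088856092357784034344960000;
  1243193655214621856908243748711520000; 5020770010088856092357784034344960000]
 [:: (306586355629605688989514400317632000, (0%N, 1), (1%N, 1));
 (11264294664951133761174889419540000, (1%N, 8), (7%N, -1));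
 (146437291864925573487659158920480000, (2%N, 2), (17%N, 1))]));
 (square_basis_alt_10, (cert_rows 37306325234937749396575680000
 [:: [:: 16962703; -2918246; 3436789; -2255389; -321182; -901896; 3241389; -263001; 158737;
  -663452; -452121; -11975625; 6651438; 825625; -195509; 151064; -553931];
 [:: 2552855; -1881053; -2394508; -253421; -645695; 2507121; -38856; -21546; 867473; -679743;
  -5957291; 2477704; 522868; 3936; -136625; -206806];
 [:: 4061804; 2106765; -894233; -536332; 2323165; -42581; -1539798; 1148981; -712800; -7443905;
  2764929; -576102; 822046; 131857; 303194];
 [:: 1665548; -406824; -762571; 2460228; -76470; 1411228; -1802338; 12080; -9643455; 3895751;
  -583701; 437152; 20245; 619041];
 [:: 305431; -209918; -397536; 164793; 1480942; -1243455; 1547315; 12941445; -4174067; 1749233;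
  -2204315; -259259; -854613];
 [:: 1531045; -1891624; -75785; 417073; 677209; -2423172; -1807473; 404359; -933647; 1378341;
  195642; 475922];
 [:: 3297176; -253845; 515489; 138046; -2900419; 9394442; -1921590; -584801; -5066979; -68136;
  2103203];
 [:: 676064; -37897; 232273; -975283; 1826219; -493200; -13729; -1200638; -78551; 314586];
 [:: 4537838; -4031415; -1293339; -22098804; 4706215; -5479835; 10677185; 797436; 1453277];
 [:: 1065635; 40146; 3025033; -1086676; 1011294; -1196273; 4956; -949107];
 [:: 2002596; 2699197; -175850; 1794461; -2747340; -473143; -935874];
 [:: 7471443; -2105249; -822681; -699726; 341062; 650507];
 [:: 3174634; 16138; -8234095; -214360; 2707247];
 [:: 2695805; -587936; -51261; -2328040];
 [:: 2248819; -22028; -770388];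
 [:: 645434; -740836];
 [:: 775292]]
 [:: 3547986638125058540913126074365993045500; 949361055037522866659386332115989211500;
  216689564148824920631872790254645836000; 246505601981877093028034322510512389500;
  57568755391963077265621660164500450625; 229710645701062410447548704900625220000;
  204785723782596421697639538887070052500; 224790001767321705666526890476438156250;
  244384649196984690376590749615368555500; 230466636784848558336478611955480293750;
  239962104764926952486409828156280320000; 3119020179224904535770411315790404361500;
  869771649332680605220695943923442590750; 964177518081091012580693590590007980000;
  726586388729587681992155892125639756250; 226018155366791244403708880911834676250;
  817221508206631379071891122540761190000]
 [:: (3742559754240186264040826570325245250, (0%N, 4), (2%N, 1));
 (961347332688156321672194048786170500, (0%N, 4), (3%N, -1));
 (9763526189631990300150335168626177500, (0%N, 4), (6%N, 1));
 (8509731061021286036326699336424572500, (0%N, 1), (11%N, 1));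
 (6747286039319862864086647558788213750, (0%N, 2), (12%N, -1));
 (36126762219533927406433566288843888750, (0%N, 2), (14%N, 1));
 (2410417317610249413751595310868822500, (1%N, 2), (2%N, 1));
 (396813824003068706096524289528801250, (1%N, 4), (4%N, -1));
 (3082300117580558973115766943930004500, (1%N, 2), (8%N, -1));
 (7015766630066427020512972203285682500, (1%N, 1), (16%N, -1));
 (98317067762131891046048399069520000, (2%N, 2), (4%N, 1));
 (3121156259758457819707451308787520000, (2%N, 1), (7%N, -1));
 (1887492576148054305490965008059200000, (2%N, 1), (9%N, 1));
 (19531353466877958258202083312289687500, (2%N, 1), (11%N, 4));
 (18809423825922140573423671772044488750, (2%N, 1), (16%N, 2));
 (395304807530133683419274523360000000, (4%N, 1), (6%N, 2));
 (3407508035705860214987739669869548125, (4%N, 1), (14%N, -4));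
 (4401843766431792304224770999979975000, (5%N, 1), (13%N, -2));
 (13354459847071046597933040658693365000, (5%N, 1), (14%N, 2));
 (4580615871431537848249531890509280000, (6%N, 1), (7%N, -1));
 (1384163658550201409930981541566880000, (6%N, 1), (10%N, 1));
 (3847205684945875678627058260391441250, (6%N, 1), (11%N, 4));
 (18683099504848948872946249999152168750, (6%N, 1), (12%N, 2));
 (139016723489812161965924957773440000, (6%N, 1), (14%N, 2));
 (83328620500327092529046827557600000, (6%N, 1), (16%N, 2));
 (4820962020982925238487968295212000000, (7%N, 1), (10%N, 1));
 (10059364786522535699349586871976243750, (7%N, 1), (11%N, -4));
 (8191620302693234933689247231280000, (7%N, 1), (13%N, 2));
 (18380481359745405953510919210960000, (7%N, 1), (14%N, 2));
 (33608634196626424489635288325440000, (7%N, 1), (15%N, 1));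
 (15112819953568636707736939595759066250, (9%N, 1), (11%N, 4));
 (1299718870105170214877738566239360000, (10%N, 1), (14%N, -2));
 (29889699494405564763672628649891080500, (11%N, 2), (12%N, 1));
 (2151699475776473061847002507300753750, (11%N, 4), (15%N, -1));
 (35436933741481004581191433800133357500, (11%N, 2), (16%N, -1));
 (11768560768442194544195098200449280000, (12%N, 1), (14%N, -1));
 (3360564445493462744731540981131000000, (13%N, 1), (14%N, -1));
 (1172431497861685555447155512798880000, (13%N, 2), (15%N, -1));
 (14461847832271701132573440934883027500, (14%N, 2), (15%N, 1));
 (40411850313428227523313038150002215000, (14%N, 1), (16%N, -1));
 (3756512514521807329506495479947462500, (15%N, 1), (16%N, -2))]))].
(** The quartic vanishes at 0, 1/9 and 1/3, which leaves -243 * 28/3 = -2268 at the rhombic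
    dodecahedron. *)
Lemma cert4_certified : certifies cert4_scale (-2268) cert4_target cert4_poles cert4_squares.
Proof. by vm_compute. Qed.

Local Close Scope Z_scope.

(** * Energies of polynomial potentials *)

Section SevenVectors.
Variable R : realType.
Implicit Types u v : 'rV[R]_3.

Lemma dotE u v : dot u v = u 0 0 * v 0 0 + u 0 1 * v 0 1 + u 0 2%:R * v 0 2%:R.
Proof.
rewrite /dot !big_ord_recl big_ord0 addr0 addrA; congr (_ + _ * _ + _ * _);
by congr (_ _ _); apply: val_inj.
Qed.

(* When [u != - e_3], the vectors [a] and [b] are the images of [e_1] and [e_2]
   under the rotation taking [e_3] to [u] about an axis orthogonal to both. *)
Lemma orthonormal_frame u : dot u u = 1 -> exists a b : 'rV[R]_3,
  forall v w, dot v w = dot u v * dot u w + dot a v * dot a w + dot b v * dot b w.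
Proof.
rewrite dotE; set x := u 0 0; set y := u 0 1; set z := u 0 2%:R => u1.
have [z1|z1] := eqVneq (1 + z) 0.
  have zE : z = -1 by lra.
  have x0 : x = 0 by nra.
  have y0 : y = 0 by nra.
  exists (delta_mx 0 0), (delta_mx 0 1) => v w.
  by rewrite !dotE !mxE /= -/x -/y -/z x0 y0 zE; ring.
pose q := (1 + z)^-1.
have qz : q * (1 + z) = 1 by rewrite /q mulVf.
have qxy : q * (x ^+ 2 + y ^+ 2) = 1 - z.
  have -> : x ^+ 2 + y ^+ 2 = (1 + z) * (1 - z).
    have -> : (1 + z) * (1 - z) = 1 - z * z by ring.
    by rewrite -u1; ring.
  by rewrite mulrA qz mul1r.
exists (\row_i [:: 1 - x ^+ 2 * q; - (x * y * q); - x]`_i),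
       (\row_i [:: - (x * y * q); 1 - y ^+ 2 * q; - y]`_i) => v w.
rewrite !dotE !mxE /= -/x -/y -/z.
(* As bilinear forms in [v] and [w], the two sides differ by multiples of these two vanishing
   expressions and of [dot u u - 1]. *)
have cE (a b : R) : a * b * (1 - 2%:R * q + q * (q * (x ^+ 2 + y ^+ 2))) = 0.
  rewrite qxy (_ : 1 - 2%:R * q + q * (1 - z) = 1 - q * (1 + z)); last by ring.
  by rewrite qz subrr mulr0.
have c02 (a : R) : a * (z - 1 + q * (x ^+ 2 + y ^+ 2)) = 0 by rewrite qxy; ring.
have := (cE x x, cE x y, cE y y, c02 x, c02 y).
move: (v 0 0) (v 0 1) (v 0 2%:R) (w 0 0) (w 0 1) (w 0 2%:R) => v0 v1 v2 w0 w1 w2.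
move=> [[[[cxx cxy] cyy] cx] cy].
transitivity (v0 * w0 + v1 * w1 + v2 * w2
  + x * x * (1 - 2%:R * q + q * (q * (x ^+ 2 + y ^+ 2))) * (v0 * w0)
  + x * y * (1 - 2%:R * q + q * (q * (x ^+ 2 + y ^+ 2))) * (v0 * w1 + v1 * w0)
  + y * y * (1 - 2%:R * q + q * (q * (x ^+ 2 + y ^+ 2))) * (v1 * w1)
  + x * (z - 1 + q * (x ^+ 2 + y ^+ 2)) * (v0 * w2 + v2 * w0)
  + y * (z - 1 + q * (x ^+ 2 + y ^+ 2)) * (v1 * w2 + v2 * w1)
  + (x * x + y * y + z * z - 1) * (v2 * w2)).
  by rewrite cxx cxy cyy cx cy u1; ring.
ring.
Qed.

Variable x : 'I_7 -> 'rV[R]_3.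
Hypothesis x1 : forall i, dot (x i) (x i) = 1.

Definition sqdot i j : R := dot (x i) (x j) ^+ 2.
Local Notation t := sqdot.

Definition pair_sum (F : R -> R) : R := \sum_i \sum_(j | j != i) F (sqdot i j).

Lemma sqdot_ge0 i j : 0 <= t i j. Proof. exact: sqr_ge0. Qed.

Lemma pair_sumD F G : pair_sum (fun s => F s + G s) = pair_sum F + pair_sum G.
Proof.
rewrite /pair_sum -big_split; apply: eq_bigr => i _ /=; exact: big_split.
Qed.

Lemma pair_sumZ c F : pair_sum (fun s => c * F s) = c * pair_sum F.
Proof. by rewrite /pair_sum mulr_sumr; apply: eq_bigr => i _; rewrite mulr_sumr. Qed.

Lemma eq_pair_sum F G : F =1 G -> pair_sum F = pair_sum G.
Proof. by move=> E; apply: eq_bigr => i _; apply: eq_bigr => j _; rewrite E. Qed.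

Lemma pair_sum_ge0 F : (forall i j, j != i -> 0 <= F (t i j)) -> 0 <= pair_sum F.
Proof. by move=> F0; apply: sumr_ge0 => i _; apply: sumr_ge0 => j; exact: F0. Qed.

Lemma pair_sum_eq0 F : (forall i j, j != i -> 0 <= F (t i j)) -> pair_sum F = 0 ->
  forall i j, j != i -> F (t i j) = 0.
Proof.
move=> F0 E i j ji; pose G i := \sum_(j | j != i) F (t i j).
have G0 k : true -> 0 <= G k by move=> _; apply: sumr_ge0 => l; exact: F0.
have := @psumr_eq0P _ _ _ G G0 E i isT.
by move/psumr_eq0P; apply => // k; exact: F0.
Qed.

Definition moment (a : nat) : R := pair_sum (fun s => s ^+ a).

Lemma certificate L e p Ks Ss : certifies L e p Ks Ss ->
  zr R e <= \sum_(c <- p) zr R c.1 * moment c.2.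
Proof.
have dC i j : dot (x i) (x j) = dot (x j) (x i) by exact: dotC.
have frames i : exists a b, forall j k : 'I_7, dot (x j) (x k) =
    dot (x i) (x j) * dot (x i) (x k) + a j * a k + b j * b k.
  have [a [b ab]] := orthonormal_frame (x1 i).
  by exists (fun j => dot a (x j)), (fun j => dot b (x j)) => j k.
move=> /(certifies_sound dC x1 frames).
congr (_ <= _); apply: eq_bigr => c _; congr (_ * _).
rewrite /Mpair /moment /pair_sum; apply: eq_bigr => i _; apply: eq_bigr => j _.
by rewrite /sqdot -muln2 mulnC exprM.
Qed.

(** Unfolds binary literals into real expressions, so that the coefficients of the certificates can
    be handled by [lra]. *)
Fixpoint posR (p : positive) : R :=
  match p with
  | xH => 1
  | xO q => 2%:R * posR q
  | xI q => 2%:R * posR q + 1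
  end.

Lemma zr_pos p : zr R (Zpos p) = posR p.
Proof.
elim: p => [p IH|p IH|] //=; rewrite -IH.
  by rewrite -[Zpos _~1]/(Z.add (Z.mul (Zpos 2) (Zpos p)) (Zpos 1)) zrD zrM.
by rewrite -[Zpos _~0]/(Z.mul (Zpos 2) (Zpos p)) zrM.
Qed.

Lemma zr_neg p : zr R (Zneg p) = - posR p.
Proof.
rewrite -zr_pos -[Zneg p]/(Z.mul (Zneg 1) (Zpos p)) zrM.
by rewrite -[zr R (Zneg 1)]/(-1 : R) mulN1r.
Qed.

(** Both additional terms on the left are nonnegative, so equality in the plain bound 16/9 forces
    both to vanish. This is the source of uniqueness. *)
Lemma moment_bound2 : 16%:R / 9%:R + 1 / 1000%:R * (moment 1 - 28%:R / 3%:R)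
  + 1 / 100%:R * pair_sum (fun s => s * (s - 1 / 9%:R) ^+ 2 * (s - 1 / 3%:R) ^+ 2)
  <= pair_sum (fun s => s * (s - 1 / 9%:R)).
Proof.
have := certificate cert2_certified.
rewrite !big_cons big_nil /= !zr_pos !zr_neg /=.
rewrite (@eq_pair_sum _ (fun s => s ^+ 5 + (- (8%:R / 9%:R) * s ^+ 4 + (22%:R / 81%:R * s ^+ 3
   + (- (8%:R / 243%:R) * s ^+ 2 + 1 / 729%:R * s ^+ 1))))); last by move=> s; field.
rewrite !pair_sumD !pair_sumZ -!/(moment _).
rewrite (@eq_pair_sum _ (fun s => s ^+ 2 + - (1 / 9%:R) * s ^+ 1)); last by move=> s; field.
rewrite !pair_sumD !pair_sumZ -!/(moment _) => H.
lra.
Qed.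

Lemma moment_bound3 : 32%:R / 81%:R <= pair_sum (fun s => s * (s - 1 / 9%:R) ^+ 2).
Proof.
have := certificate cert3_certified.
rewrite !big_cons big_nil /= !zr_pos !zr_neg /=.
rewrite (@eq_pair_sum _ (fun s => s ^+ 3 + (- (2%:R / 9%:R) * s ^+ 2 + 1 / 81%:R * s ^+ 1)));
  last by move=> s; field.
rewrite !pair_sumD !pair_sumZ -!/(moment _) => H.
lra.
Qed.

Lemma moment_bound4 : 1 / 100%:R ^+ 2 * (moment 1 - 28%:R / 3%:R) <=
  pair_sum (fun s => s * (s - 1 / 9%:R) ^+ 2 * (s - 1 / 3%:R)).
Proof.
have := certificate cert4_certified.
rewrite !big_cons big_nil /= !zr_pos !zr_neg /=.
rewrite (@eq_pair_sum _ (fun s => s ^+ 4 + (- (5%:R / 9%:R) * s ^+ 3 + (7%:R / 81%:R * s ^+ 2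
   + - (1 / 243%:R) * s ^+ 1)))); last by move=> s; field.
rewrite !pair_sumD !pair_sumZ -!/(moment _) => H.
lra.
Qed.

(** Entries of the frame operator, the sum of the projections to the seven lines; the frame is tight
    when it is 7/3 times the identity. *)
Definition frame_entry (a b : 'I_3) : R := \sum_i x i 0 a * x i 0 b.

Lemma sum_frame_entry (c : 'I_3 -> 'I_3 -> R) : \sum_a \sum_b c a b * frame_entry a b =
  \sum_i \sum_a \sum_b c a b * (x i 0 a * x i 0 b).
Proof.
rewrite [RHS]exchange_big; apply: eq_bigr => a _.
by rewrite [RHS]exchange_big; apply: eq_bigr => b _; rewrite mulr_sumr.
Qed.

Lemma sqdotE i j : t i j = \sum_a \sum_b x i 0 a * x i 0 b * (x j 0 a * x j 0 b).
Proof.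
rewrite /sqdot /dot expr2 mulr_suml; apply: eq_bigr => a _.
by rewrite mulr_sumr; apply: eq_bigr => b _; ring.
Qed.

Lemma sum_sqdot i : \sum_j t i j = 1 + \sum_(j | j != i) t i j.
Proof. by rewrite (bigD1 i) //= /sqdot x1 expr1n. Qed.

(** The left side is the squared Hilbert-Schmidt distance from the frame operator S to 7/3 times the
    identity; expand with tr S = 7 and tr S^2 = 7 + [moment 1]. *)
Lemma frame_defect :
  \sum_a \sum_b (frame_entry a b - 7%:R / 3%:R * (a == b)%:R) ^+ 2 =
  moment 1 - 28%:R / 3%:R.
Proof.
have F2 : \sum_a \sum_b frame_entry a b * frame_entry a b = 7%:R + moment 1.
  rewrite sum_frame_entry (eq_bigr (fun i => 1 + \sum_(j | j != i) t i j)).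
    by rewrite big_split /= sumr_const card_ord.
  move=> i _; rewrite -sum_sqdot (eq_bigr _ (fun j _ => sqdotE i j)) [RHS]exchange_big.
  apply: eq_bigr => a _; rewrite [RHS]exchange_big; apply: eq_bigr => b _.
  by rewrite mulrC mulr_sumr.
have F1 : \sum_a \sum_b (a == b)%:R * frame_entry a b = 7%:R.
  rewrite sum_frame_entry (eq_bigr (fun=> 1)) ?sumr_const ?card_ord // => i _.
  rewrite -[RHS](x1 i); apply: eq_bigr => a _; rewrite (bigD1 a) //= eqxx mulr1n mul1r.
  by rewrite big1 ?addr0 // => b ba; rewrite eq_sym (negPf ba) mul0r.
have F0 : \sum_(a < 3) \sum_(b < 3) (a == b)%:R = 3%:R :> R.
  rewrite (eq_bigr (fun=> 1)) ?sumr_const ?card_ord // => a _.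
  by rewrite (bigD1 a) //= eqxx big1 ?addr0 // => b ba; rewrite eq_sym (negPf ba).
transitivity (\sum_a \sum_b frame_entry a b * frame_entry a b
  - 14%:R / 3%:R * (\sum_a \sum_b (a == b)%:R * frame_entry a b)
  + 49%:R / 9%:R * (\sum_(a < 3) \sum_(b < 3) (a == b)%:R)); last first.
  by rewrite F2 F1 F0; field.
rewrite !mulr_sumr -sumrB -big_split; apply: eq_bigr => a _ /=.
rewrite !mulr_sumr -sumrB -big_split; apply: eq_bigr => b _ /=.
by case: (a == b) => /=; field.
Qed.

Lemma moment1_ge : 28%:R / 3%:R <= moment 1.
Proof.
rewrite -subr_ge0 -frame_defect; apply: sumr_ge0 => a _; apply: sumr_ge0 => b _.
exact: sqr_ge0.
Qed.

(** The defect vanishes, so the quadratic form of the frame operator takes the value 7/3 at [x i];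
    the term [j = i] accounts for 1. *)
Lemma tight_frame : moment 1 = 28%:R / 3%:R ->
  forall i, \sum_(j | j != i) t i j = 4%:R / 3%:R.
Proof.
move=> m1 i; have := frame_defect; rewrite m1 subrr => /psumr_eq0P H.
have F a b : frame_entry a b = 7%:R / 3%:R * (a == b)%:R.
  have G0 c : true -> 0 <= \sum_b (frame_entry c b - 7%:R / 3%:R * (c == b)%:R) ^+ 2.
    by move=> _; apply: sumr_ge0 => d _; exact: sqr_ge0.
  have /psumr_eq0P h := H G0 a isT.
  have /eqP := h (fun c _ => sqr_ge0 _) b isT.
  by rewrite sqrf_eq0 subr_eq0 => /eqP.
have : \sum_j t i j = 7%:R / 3%:R.
  rewrite (eq_bigr _ (fun j _ => sqdotE i j)).
  rewrite -(sum_frame_entry (fun a b => x i 0 a * x i 0 b)).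
  have -> : 7%:R / 3%:R = 7%:R / 3%:R * dot (x i) (x i) by rewrite x1 mulr1.
  rewrite mulr_sumr; apply: eq_bigr => a _.
  rewrite (bigD1 a) //= F eqxx big1 ?addr0; first by rewrite mulr1n; ring.
  by move=> b ba; rewrite F eq_sym (negPf ba) mulr0 mulr0.
by rewrite sum_sqdot => h; lra.
Qed.

(** Sum over the ordered pairs of the rhombic dodecahedron, hence twice the numbers 3, 6 and 12 of
    pairs. *)
Definition design_energy (F : R -> R) : R :=
  6%:R * F 0 + 12%:R * F (1 / 9%:R) + 24%:R * F (1 / 3%:R).

(** What equality in the bounds says about a code; it determines the code up to isometry. *)
Definition rigid := (forall i j, j != i -> [|| t i j == 0, t i j == 1 / 9%:R | t i j == 1 / 3%:R])
  /\ (forall i, \sum_(j | j != i) t i j = 4%:R / 3%:R).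

Lemma rigid_of_roots :
  pair_sum (fun s => s * (s - 1 / 9%:R) ^+ 2 * (s - 1 / 3%:R) ^+ 2) = 0 ->
  moment 1 = 28%:R / 3%:R -> rigid.
Proof.
move=> rs0 m1; split=> [i j ji|]; last exact: tight_frame.
have rs_ge0 k l : l != k -> 0 <= t k l * (t k l - 1 / 9%:R) ^+ 2 * (t k l - 1 / 3%:R) ^+ 2.
  by move=> _; rewrite mulr_ge0 ?sqr_ge0 // mulr_ge0 ?sqr_ge0.
have /eqP := pair_sum_eq0 (F := fun s => s * (s - 1 / 9%:R) ^+ 2 * (s - 1 / 3%:R) ^+ 2)
  rs_ge0 rs0 ji.
by rewrite mulf_eq0 sqrf_eq0 mulf_eq0 [X in _ || X || _]sqrf_eq0 sqrf_eq0 !subr_eq0 -orbA.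
Qed.

End SevenVectors.

(** * Polynomials with nonnegative coefficients and their division by X - a *)

Section NonnegativeCoefficients.
Variable R : realFieldType.
Implicit Types p q : {poly R}.

Definition nneg_coef p := forall i, 0 <= p`_i.

Lemma nneg_horner p (a : R) : nneg_coef p -> 0 <= a -> 0 <= p.[a].
Proof.
move=> p0 a0; rewrite horner_coef; apply: sumr_ge0 => i _.
by rewrite mulr_ge0 ?exprn_ge0.
Qed.

Lemma nneg_horner_gt0 p (a : R) : nneg_coef p -> p != 0 -> 0 < a -> 0 < p.[a].
Proof.
move=> pn p0 a0; rewrite horner_coef.
have n0 : (0 < size p)%N by rewrite size_poly_gt0.
have lt : ((size p).-1 < size p)%N by rewrite ltn_predL.
rewrite (bigD1 (Ordinal lt)) //= ltr_wpDr //.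
  by apply: sumr_ge0 => i _; rewrite mulr_ge0 ?exprn_ge0 ?(ltW a0).
by rewrite mulr_gt0 ?exprn_gt0 // lt_neqAle eq_sym -lead_coefE lead_coef_eq0 p0 lead_coefE pn.
Qed.

(** In Horner's scheme the coefficients of the quotient are values at [a] of polynomials formed from
    the upper coefficients of [p], hence nonnegative. The bound on sizes serves to show that later
    quotients do not vanish. *)
Lemma nneg_divX p (a : R) : nneg_coef p -> 0 <= a ->
  exists q, [/\ nneg_coef q, (size p <= (size q).+1)%N &
             forall s, p.[s] = p.[a] + (s - a) * q.[s]].
Proof.
move=> pn a0.
have [q [qn E]] : exists q, nneg_coef q /\ p = p.[a]%:P + ('X - a%:P) * q.
  elim/poly_ind: p pn => [|p c IH] pn.
    by exists 0; split=> [i|]; rewrite ?coef0 // horner0 mulr0 addr0.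
  have pn' : nneg_coef p.
    by move=> i; have := pn i.+1; rewrite coefD coefMX coefC /= addr0.
  have [q [qn E]] := IH pn'.
  exists (p.[a]%:P + 'X * q); split.
    move=> i; rewrite coefD coefC coefXM.
    by case: i => [|i] /=; rewrite ?addr0 ?add0r ?nneg_horner.
  by rewrite {1}E !hornerE polyCD polyCM; ring.
exists q; split=> //; last by move=> s; rewrite {1}E !hornerE.
rewrite {1}E (leq_trans (size_polyD _ _)) // geq_max.
rewrite (leq_trans (size_polyC_leq1 _)) //=.
by rewrite (leq_trans (size_polyMleq _ _)) // size_XsubC.
Qed.

End NonnegativeCoefficients.

(** * Lower bounds for polynomial energies and their cases of equality *)

Section PolynomialEnergies.
Variables (R : realType) (x : 'I_7 -> 'rV[R]_3).
Hypothesis x1 : forall i, dot (x i) (x i) = 1.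

(** The Newton form of [p] with nodes 0, 1/9, 1/9, 1/3, 1/3 has nonnegative coefficients, and each
    of its terms satisfies a sharp bound. From degree 2 on, the coefficient of t(t-1/9) is positive,
    and equality there gives rigidity. *)
Lemma poly_energy (p : {poly R}) : nneg_coef p ->
  design_energy (fun s => p.[s]) <= pair_sum x (fun s => p.[s]) /\
  (pair_sum x (fun s => p.[s]) = design_energy (fun s => p.[s]) -> (2 < size p)%N ->
   rigid x).
Proof.
move=> p0.
have h9 : 0 <= 1 / 9%:R :> R by lra.
have h3 : 0 <= 1 / 3%:R :> R by lra.
(* The node 0 is simple because t = 0 is an endpoint; the double nodes 1/9 and 1/3 make the factor
   multiplying [p5] nonnegative. *)
have [p1 [n1 s1 E1]] := nneg_divX p0 (lexx 0).
have [p2 [n2 s2 E2]] := nneg_divX n1 h9.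
have [p3 [n3 s3 E3]] := nneg_divX n2 h9.
have [p4 [n4 s4 E4]] := nneg_divX n3 h3.
have [p5 [n5 s5 E5]] := nneg_divX n4 h3.
pose rest s := s * (s - 1 / 9%:R) ^+ 2 * (s - 1 / 3%:R) ^+ 2 * p5.[s].
have rest0 : 0 <= pair_sum x rest.
  apply: pair_sum_ge0 => i j _; rewrite mulr_ge0 ?nneg_horner ?sqdot_ge0 //.
  by rewrite mulr_ge0 ?sqr_ge0 // mulr_ge0 ?sqr_ge0.
have E s : p.[s] = p.[0] * s ^+ 0 + (p1.[1 / 9%:R] * s ^+ 1 + (p2.[1 / 9%:R] * (s * (s - 1 / 9%:R))
    + (p3.[1 / 3%:R] * (s * (s - 1 / 9%:R) ^+ 2)
    + (p4.[1 / 3%:R] * (s * (s - 1 / 9%:R) ^+ 2 * (s - 1 / 3%:R)) + rest s)))).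
  by rewrite E1 E2 E3 E4 E5 /rest; ring.
have Esum : pair_sum x (fun s => p.[s]) = 42%:R * p.[0] + p1.[1 / 9%:R] * moment x 1
    + p2.[1 / 9%:R] * pair_sum x (fun s => s * (s - 1 / 9%:R))
    + p3.[1 / 3%:R] * pair_sum x (fun s => s * (s - 1 / 9%:R) ^+ 2)
    + p4.[1 / 3%:R] * pair_sum x (fun s => s * (s - 1 / 9%:R) ^+ 2 * (s - 1 / 3%:R))
    + pair_sum x rest.
  rewrite (eq_pair_sum _ E) !pair_sumD !pair_sumZ.
  have -> : pair_sum x (fun s => s ^+ 0) = 42%:R by exact: Mpair0 (fun i j => sqdot x i j).
  rewrite /moment; ring.
have Edes : design_energy (fun s => p.[s]) = 42%:R * p.[0] + p1.[1 / 9%:R] * (28%:R / 3%:R)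
    + p2.[1 / 9%:R] * (16%:R / 9%:R) + p3.[1 / 3%:R] * (32%:R / 81%:R).
  by rewrite /design_energy (E (1 / 9%:R)) (E (1 / 3%:R)) /rest; field.
have B1 := moment1_ge x1; have B2 := moment_bound2 x1.
have B3 := moment_bound3 x1; have B4 := moment_bound4 x1.
set rs := pair_sum x (fun s => s * (s - 1 / 9%:R) ^+ 2 * (s - 1 / 3%:R) ^+ 2) in B2.
have rs0 : 0 <= rs.
  by apply: pair_sum_ge0 => i j _; rewrite mulr_ge0 ?sqr_ge0 // mulr_ge0 ?sqr_ge0.
have c1 := nneg_horner n1 h9; have c2 := nneg_horner n2 h9.
have c3 := nneg_horner n3 h3; have c4 := nneg_horner n4 h3.
set q2 := pair_sum x (fun s => s * (s - 1 / 9%:R)) in B2 Esum.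
set q3 := pair_sum x (fun s => s * (s - 1 / 9%:R) ^+ 2) in B3 Esum.
set q4 := pair_sum x (fun s => s * (s - 1 / 9%:R) ^+ 2 * (s - 1 / 3%:R)) in B4 Esum.
have D1 : 0 <= p1.[1 / 9%:R] * (moment x 1 - 28%:R / 3%:R) by rewrite mulr_ge0 // subr_ge0.
have D2' : 0 <= q2 - 16%:R / 9%:R by lra.
have D2 : 0 <= p2.[1 / 9%:R] * (q2 - 16%:R / 9%:R) by rewrite mulr_ge0.
have D3 : 0 <= p3.[1 / 3%:R] * (q3 - 32%:R / 81%:R) by rewrite mulr_ge0 // subr_ge0.
have D4 : 0 <= p4.[1 / 3%:R] * q4 by rewrite mulr_ge0 //; lra.
have Ediff : pair_sum x (fun s => p.[s]) - design_energy (fun s => p.[s]) =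
    p1.[1 / 9%:R] * (moment x 1 - 28%:R / 3%:R) + p2.[1 / 9%:R] * (q2 - 16%:R / 9%:R)
    + p3.[1 / 3%:R] * (q3 - 32%:R / 81%:R) + p4.[1 / 3%:R] * q4 + pair_sum x rest.
  by rewrite Esum Edes; ring.
split=> [|eqE sp]; first by rewrite -subr_ge0 Ediff !addr_ge0.
(* Two divisions lower the size by at most 2, so [p2] is nonzero. *)
have c2' : 0 < p2.[1 / 9%:R].
  apply: nneg_horner_gt0 => //.
  by rewrite -size_poly_gt0; move: (leq_trans sp s1); rewrite ltnS => /leq_trans/(_ s2).
have /eqP : p2.[1 / 9%:R] * (q2 - 16%:R / 9%:R) = 0.
  (* With the products replaced by variables the problem is linear: nonnegative numbers with sum
     zero vanish. *)
  move: Ediff D1 D2 D3 D4 rest0; rewrite eqE subrr.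
  move: (_ * (moment x 1 - _)) (_ * (q2 - _)) (_ * (q3 - _)) (_ * q4) (pair_sum x rest).
  by move=> *; lra.
rewrite mulf_eq0 gt_eqF //= => /eqP q20.
by apply: rigid_of_roots => //; rewrite -?/rs; lra.
Qed.

(** Under the hypothesis the quartic is nonpositive at every pair, whereas its sum is bounded below
    by a positive multiple of the defect of tightness. Hence the defect and all terms vanish. *)
Lemma rigid_of_small_sqdot : (forall i j, j != i -> sqdot x i j <= 1 / 3%:R) -> rigid x.
Proof.
move=> le3; pose F s : R := - (s * (s - 1 / 9%:R) ^+ 2 * (s - 1 / 3%:R)).
have F0 i j : j != i -> 0 <= F (sqdot x i j).
  move=> /le3 h; rewrite /F -mulrN mulr_ge0 //; last by lra.
  by rewrite mulr_ge0 ?sqr_ge0.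
have B1 := moment1_ge x1; have B4 := moment_bound4 x1.
have := pair_sum_ge0 F0.
rewrite (@eq_pair_sum _ _ F (fun s => -1 * (s * (s - 1 / 9%:R) ^+ 2 * (s - 1 / 3%:R))));
  last by move=> s; rewrite mulN1r.
rewrite pair_sumZ => B5.
have m1 : moment x 1 = 28%:R / 3%:R by lra.
apply: rigid_of_roots => //; apply: big1 => i _; apply: big1 => j ji.
have E : pair_sum x F = 0.
  rewrite (@eq_pair_sum _ _ F (fun s => -1 * (s * (s - 1 / 9%:R) ^+ 2 * (s - 1 / 3%:R))));
    last by move=> s; rewrite mulN1r.
  by rewrite pair_sumZ; lra.
have := pair_sum_eq0 F0 E ji; rewrite /F => h.
move: (sqdot x i j) h => s h.
(* One more factor [s - 1 / 3] turns the vanishing quartic into the required quintic. *)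
transitivity (- (- (s * (s - 1 / 9%:R) ^+ 2 * (s - 1 / 3%:R))) * (s - 1 / 3%:R)).
  by ring.
by rewrite h oppr0 mul0r.
Qed.

End PolynomialEnergies.

(** * Rigidity *)

(** Handshake argument: the related pairs with [j < i] and those with [i < j] are equally many. *)
Lemma symmetric_rel_even n (r : rel 'I_n) : symmetric r -> irreflexive r ->
  ~~ odd (\sum_i \sum_j r i j).
Proof.
move=> rC r0.
suff -> : (\sum_i \sum_j r i j = (\sum_(i < n) \sum_(j < n | (j < i)%N) r i j).*2)%N.
  by rewrite odd_double.
rewrite -addnn; have E : (\sum_(i < n) \sum_(j < n | (j < i)%N) r i j =
    \sum_(i < n) \sum_(j < n | (i < j)%N) r i j)%N.
  rewrite (exchange_big_dep xpredT) //=; apply: eq_bigr => i _.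
  by apply: eq_bigr => j _; rewrite rC.
rewrite {2}E -big_split; apply: eq_bigr => i _ /=.
rewrite (bigID (fun j : 'I_n => (j < i)%N)) /=; congr (_ + _)%N.
rewrite (bigID (fun j : 'I_n => j == i)) /= big1 ?add0n => [|j /andP[_ /eqP->]]; last by rewrite r0.
by apply: eq_bigl => j; rewrite -leqNgt ltn_neqAle eq_sym andbC.
Qed.

Section Rigid.
Variables (R : realType) (x : 'I_7 -> 'rV[R]_3).
Hypothesis x1 : forall i, dot (x i) (x i) = 1.
Hypothesis rigid_x : rigid x.
Local Notation t := (sqdot x).

Lemma sqdotC i j : t i j = t j i. Proof. by rewrite /sqdot dotC. Qed.

Definition at_sqdot (c : R) i : {set 'I_7} := [set j | (j != i) && (t i j == c)].

Lemma at_sqdotC c i j : (j \in at_sqdot c i) = (i \in at_sqdot c j).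
Proof. by rewrite !inE eq_sym sqdotC. Qed.

(** With n0, n9, n3 the numbers of points at 0, 1/9, 1/3, counting gives n0 + n9 + n3 = 6 and
    tightness gives n9 + 3 n3 = 12; only (2, 0, 4) and (0, 3, 3) are possible. *)
Lemma valency i : (#|at_sqdot 0 i| = 2 /\ #|at_sqdot (1 / 9%:R) i| = 0)%N \/
  (#|at_sqdot 0 i| = 0 /\ #|at_sqdot (1 / 9%:R) i| = 3)%N.
Proof.
have [h hs] := rigid_x.
have cardE c : #|at_sqdot c i|%:R = \sum_(j | j != i) (t i j == c)%:R :> R.
  rewrite -sum1_card natr_sum (eq_bigl (fun j => (j != i) && (t i j == c))).
    by rewrite big_mkcondr; apply: eq_bigr => j _; case: eqP.
  by move=> j; rewrite inE.
have n6 : (#|at_sqdot 0 i| + #|at_sqdot (1 / 9%:R) i| + #|at_sqdot (1 / 3%:R) i| = 6)%N.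
  apply/eqP; rewrite -(eqr_nat R) !natrD !cardE -!big_split /=.
  have -> : 6%:R = \sum_(j | j != i) 1 :> R by rewrite sumr_const card_neq.
  apply/eqP; apply: eq_bigr => j ji /=.
  case/or3P: (h i j ji) => /eqP ->; rewrite eqxx ?eqr_nat.
  - by rewrite !(eq_sym 0) !gt_eqF ?divr_gt0 ?ltr0n //= !addr0.
  - by rewrite gt_eqF ?lt_eqF //=; lra.
  - by rewrite gt_eqF ?gt_eqF //=; lra.
have n12 : (#|at_sqdot (1 / 9%:R) i| + 3 * #|at_sqdot (1 / 3%:R) i| = 12)%N.
  apply/eqP; rewrite -(eqr_nat R) natrD natrM !cardE.
  have <- : 9%:R * \sum_(j | j != i) t i j = 12%:R by rewrite hs; lra.
  rewrite !mulr_sumr -big_split /=; apply/eqP; apply: eq_bigr => j ji /=.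
  case/or3P: (h i j ji) => /eqP ->; rewrite ?eqxx.
  - by rewrite !(eq_sym 0) !gt_eqF ?divr_gt0 ?ltr0n //= !mulr0 addr0.
  - by rewrite lt_eqF //=; lra.
  - by rewrite gt_eqF //=; lra.
lia.
Qed.

(** Otherwise the relation t = 1/9 would be a 3-regular graph on 7 vertices, with the odd degree sum
    21. *)
Lemma some_orthogonal : exists i, at_sqdot 0 i != finset.set0.
Proof.
apply/existsP; rewrite -[X in is_true X]negbK; apply/negP => /existsPn H.
pose r i j := j \in at_sqdot (1 / 9%:R) i.
have rC : symmetric r by move=> i j; rewrite /r at_sqdotC.
have r0 : irreflexive r by move=> i; rewrite /r inE eqxx.
apply/negP: (symmetric_rel_even rC r0).
rewrite (eq_bigr (fun=> 3%N)) ?sum_nat_const ?card_ord // => i _.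
have [[n0 _]|[_ n9]] := valency i.
  by have := H i; rewrite -card_gt0 n0.
by transitivity #|at_sqdot (1 / 9%:R) i|; rewrite // -sum1_card [RHS]big_mkcond.
Qed.

(** Excludes paths p, q, r, s in the orthogonality graph, as 4/9 is not an admissible value. In the
    plane orthogonal to q, the projection of s has squared length 2/3 and is orthogonal to r, so
    (p.s)^2 = 2/3 (1 - 1/3). *)
Lemma orthogonal_path (p q r s : 'rV[R]_3) :
  dot p p = 1 -> dot q q = 1 -> dot r r = 1 -> dot s s = 1 ->
  dot q p = 0 -> dot q r = 0 -> dot r s = 0 ->
  dot p r ^+ 2 = 1 / 3%:R -> dot q s ^+ 2 = 1 / 3%:R -> dot p s ^+ 2 = 4%:R / 9%:R.
Proof.
move=> p1 q1 r1 s1 qp qr rs pr qs; have [a [b fr]] := orthonormal_frame q1.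
move: p1 r1 s1 rs pr; rewrite (fr p p) (fr r r) (fr s s) (fr r s) (fr p r) (fr p s).
rewrite qp qr !mul0r !add0r -[dot q s * _]expr2 qs.
move: (dot a p) (dot b p) (dot a r) (dot b r) (dot a s) (dot b s) => pa pb ra rb sa sb.
move=> p1 r1 s1 rs pr.
have s2 : sa * sa + sb * sb = 2%:R / 3%:R by lra.
(* Lagrange's identity in the plane, for p and r, then for s and r. The product p.s is then expanded
   in the basis formed by r and its quarter turn. *)
have E1 : (pa * rb - pb * ra) ^+ 2 = 2%:R / 3%:R.
  have -> : (pa * rb - pb * ra) ^+ 2 =
    (pa * pa + pb * pb) * (ra * ra + rb * rb) - (pa * ra + pb * rb) ^+ 2 by ring.
  by rewrite p1 r1 pr; lra.
have E2 : (sa * rb - sb * ra) ^+ 2 = 2%:R / 3%:R.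
  have -> : (sa * rb - sb * ra) ^+ 2 =
    (sa * sa + sb * sb) * (ra * ra + rb * rb) - (ra * sa + rb * sb) ^+ 2 by ring.
  by rewrite s2 r1 rs; lra.
have -> : pa * sa + pb * sb = (pa * rb - pb * ra) * (sa * rb - sb * ra).
  transitivity ((pa * sa + pb * sb) * (ra * ra + rb * rb)); first by rewrite r1 mulr1.
  transitivity ((ra * sa + rb * sb) * (pa * ra + pb * rb) +
    (pa * rb - pb * ra) * (sa * rb - sb * ra)); first by ring.
  by rewrite rs mul0r add0r.
by rewrite exprMn E1 E2; lra.
Qed.

(** A point with an orthogonal neighbour has exactly two, and its other four values are 1/3. The
    neighbours of [i] are shown to be orthogonal to each other. *)
Lemma orthonormal_triple : exists a b c : 'I_7, [/\ uniq [:: a; b; c],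
  dot (x a) (x b) = 0, dot (x a) (x c) = 0, dot (x b) (x c) = 0 &
  forall l, l \notin [:: a; b; c] ->
    [/\ t a l = 1 / 3%:R, t b l = 1 / 3%:R & t c l = 1 / 3%:R]].
Proof.
have [h hs] := rigid_x.
have tri i j k : at_sqdot 0 i = [set j; k]%SET -> j != k ->
    [/\ j != i, k != i, dot (x i) (x j) = 0, dot (x i) (x k) = 0 &
    forall l, l \notin [:: i; j; k] -> t i l = 1 / 3%:R].
  move=> E jk.
  have : j \in at_sqdot 0 i by rewrite E !inE eqxx.
  have : k \in at_sqdot 0 i by rewrite E !inE eqxx orbT.
  rewrite !inE /sqdot !sqrf_eq0 => /andP[ki /eqP ik] /andP[ji /eqP ij]; split=> // l.
  rewrite !inE !negb_or => /and3P[li lj lk].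
  case/or3P: (h i l li) => /eqP // tl.
    have : l \in at_sqdot 0 i by rewrite inE li tl eqxx.
    by rewrite E !inE (negPf lj) (negPf lk).
  have : l \in at_sqdot (1 / 9%:R) i by rewrite inE li tl eqxx.
  have [[_ /eqP]|[/eqP]] := valency i; last by rewrite E cards2 jk.
  by rewrite cards_eq0 => /eqP->; rewrite inE.
have pair i j : j \in at_sqdot 0 i -> exists k, at_sqdot 0 i = [set j; k]%SET /\ j != k.
  move=> ji; have [[/eqP n2 _]|[/eqP n0 _]] := valency i; last first.
    by move: n0; rewrite cards_eq0 => /eqP E; rewrite E inE in ji.
  have [p [q [pq E]]] := cards2P _ n2.
  move: ji; rewrite E !inE => /orP[]/eqP->; first by exists q.
  by exists p; rewrite finset.setUC eq_sym.
have [i /finset.set0Pn[j ji]] := some_orthogonal.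
have [k [Ei jk]] := pair _ _ ji.
have [nji nki dij dik ti] := tri _ _ _ Ei jk.
have ki : k \in at_sqdot 0 i by rewrite Ei !inE eqxx orbT.
have [m [Ek im]] := pair k i (etrans (at_sqdotC 0 k i) ki).
have [nik nmk dki dkm tk] := tri _ _ _ Ek im.
(* If the second neighbour [m] of [k] were not [j], then [j], [i], [k], [m] would be an excluded
   path. *)
have [mj|mj] := eqVneq m j; last first.
  have tjk : t j k = 1 / 3%:R.
    have [l [Ej il]] := pair j i (etrans (at_sqdotC 0 j i) ji).
    have [nij nlj dji djl tj] := tri _ _ _ Ej il.
    apply: tj; rewrite !inE !negb_or nki eq_sym jk /=; apply/eqP => kl.
    have : j \in at_sqdot 0 k by rewrite at_sqdotC Ej kl !inE eqxx orbT.
    by rewrite Ek !inE (negPf nji) eq_sym (negPf mj).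
  have tim : t i m = 1 / 3%:R.
    by apply: ti; rewrite !inE !negb_or (eq_sym m i) im mj nmk.
  have := orthogonal_path (x1 j) (x1 i) (x1 k) (x1 m) dij dik dkm tjk tim.
  move=> tjm; exfalso.
  have := h j m mj; rewrite /sqdot tjm => /or3P[]/eqP; lra.
subst m.
have [l [Ej il]] := pair j i (etrans (at_sqdotC 0 j i) ji).
have lk : l = k.
  have : k \in at_sqdot 0 j by rewrite at_sqdotC Ek !inE eqxx orbT.
  by rewrite Ej !inE (negPf nki) => /eqP.
subst l.
have [_ _ dji djk tj] := tri _ _ _ Ej il.
exists i, j, k; split=> //; first by rewrite /= !inE negb_or !(eq_sym i) nji nki jk.
move=> l nl; split; [exact: ti|apply: tj|apply: tk];
by move: nl; rewrite !inE !negb_or => /and3P[-> -> ->].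
Qed.

End Rigid.

(** * Seven-point subsets of the projective plane *)

Section SevenLines.
Variable R : realType.
Implicit Types (u v : 'rV[R]_3) (p q : RP2 R).

Lemma dotDl u v w : dot (u + v) w = dot u w + dot v w.
Proof. by rewrite /dot -big_split; apply: eq_bigr => i _; rewrite mxE mulrDl. Qed.

Lemma dotNl u v : dot (- u) v = - dot u v.
Proof. by rewrite -scaleN1r dotZl mulN1r. Qed.

(** Cauchy-Schwarz with its equality case: u - (u.v)v has squared length 1 - (u.v)^2. *)
Lemma sqdot_line u v : dot u u = 1 -> dot v v = 1 ->
  dot u v ^+ 2 <= 1 /\ (dot u v ^+ 2 = 1 -> u = dot u v *: v).
Proof.
move=> u1 v1; set w := u - dot u v *: v.
have E : dot w w = 1 - dot u v ^+ 2.
  rewrite /w dotDl dotNl dotZl ![dot _ (u - _)]dotC !dotDl !dotNl !dotZl u1 v1 (dotC v u).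
  by ring.
have w0 : 0 <= dot w w by apply: sumr_ge0 => i _; rewrite -expr2 sqr_ge0.
split=> [|uv1]; first by rewrite -subr_ge0 -E.
apply/eqP; rewrite -subr_eq0 -/w; apply: contraPT E => /dot_gt0.
by rewrite uv1 subrr => /gt_eqF/negbT/eqP.
Qed.

Lemma line_unit_rep p : <[unit_rep p]>%VS = \val p.
Proof.
have u0 : unit_rep p != 0.
  by apply/eqP => u0; have /eqP := unit_rep_unit p;
  rewrite u0 -[0](scale0r 0) dotZl mul0r eq_sym oner_eq0.
by apply/eqP; rewrite eqEdim -memvE unit_rep_in dim_vline u0 dim_RP2.
Qed.

Lemma sqdot_lt1 p q : q != p -> dot (unit_rep p) (unit_rep q) ^+ 2 < 1.
Proof.
move=> qp; have [le1 eq1] := sqdot_line (unit_rep_unit p) (unit_rep_unit q).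
rewrite lt_neqAle le1 andbT; apply: contra qp => /eqP h.
apply/eqP/val_inj; rewrite -!line_unit_rep; apply/esym/eqP.
rewrite eqEdim -memvE {1}(eq1 h) memvZ ?memv_line //=.
by rewrite !line_unit_rep !dim_RP2.
Qed.

Lemma chordal_sqr p q : chordal p q ^+ 2 = 1 - dot (unit_rep p) (unit_rep q) ^+ 2.
Proof.
rewrite /chordal sqr_sqrtr // subr_ge0.
by have [] := sqdot_line (unit_rep_unit p) (unit_rep_unit q).
Qed.

Lemma chordal_ge0 p q : 0 <= chordal p q.
Proof. exact: sqrtr_ge0. Qed.

Section Enumeration.
Variable C : {fset RP2 R}.
Hypothesis card_C : #|` C|%fset = 7%N.

Definition code_point (i : 'I_7) : RP2 R := nth (@line3 R 1 0 0 isT) (enum_fset C) i.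
Definition code_vector (i : 'I_7) : 'rV[R]_3 := unit_rep (code_point i).

Lemma size_C : size (enum_fset C) = 7%N. Proof. by []. Qed.

Lemma code_point_in i : code_point i \in C.
Proof. by rewrite /code_point [_ \in C]mem_nth // size_C. Qed.

Lemma code_point_inj : injective code_point.
Proof.
move=> i j /eqP; rewrite nth_uniq ?size_C ?fset_uniq // => /eqP; exact: val_inj.
Qed.

Lemma code_pointP p : p \in C -> exists i, p = code_point i.
Proof.
move=> pC; have lt : (index p (enum_fset C) < 7)%N by rewrite -size_C index_mem.
by exists (Ordinal lt); rewrite /code_point nth_index.
Qed.

Lemma code_vector1 i : dot (code_vector i) (code_vector i) = 1. Proof. exact: unit_rep_unit. Qed.

Lemma sum_code_points (V : nmodType) (P : RP2 R -> bool) (F : RP2 R -> V) :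
  \sum_(p <- C | P p) F p = \sum_(i < 7 | P (code_point i)) F (code_point i).
Proof. by rewrite (big_nth (@line3 R 1 0 0 isT)) size_C big_mkord. Qed.

Lemma energyE f : energy f C = 2^-1 * pair_sum code_vector (fun s => f (1 - s)).
Proof.
rewrite /energy sum_code_points; congr (_ * _); apply: eq_bigr => i _.
rewrite sum_code_points; apply: eq_big => [j|j _]; first by rewrite (inj_eq code_point_inj).
by rewrite chordal_sqr.
Qed.

Lemma sqdot_code_lt1 i j : j != i -> sqdot code_vector i j < 1.
Proof. by move=> ji; apply: sqdot_lt1; rewrite (inj_eq code_point_inj). Qed.

End Enumeration.
End SevenLines.

(** * The rhombic dodecahedron *)

(** [a], [b], [c] stand for the axes and [d], [e], [f], [g] for the diagonals of the cube. With an
    abstract [G], the 42 terms are expanded over variables. *)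
Lemma sum_pairs7 (T : eqType) (V : comNzRingType) (G : T -> T -> V)
    (v0 v9 v3 : V) (a b c d e f g : T) :
  (forall p q, G p q = G q p) -> uniq [:: a; b; c; d; e; f; g] ->
  G a b = v0 -> G a c = v0 -> G a d = v3 -> G a e = v3 -> G a f = v3 ->
  G a g = v3 -> G b c = v0 -> G b d = v3 -> G b e = v3 -> G b f = v3 ->
  G b g = v3 -> G c d = v3 -> G c e = v3 -> G c f = v3 -> G c g = v3 ->
  G d e = v9 -> G d f = v9 -> G d g = v9 -> G e f = v9 -> G e g = v9 ->
  G f g = v9 ->
  \sum_(p <- [:: a; b; c; d; e; f; g])
    \sum_(q <- [:: a; b; c; d; e; f; g] | q != p) G p q =
  6%:R * v0 + 12%:R * v9 + 24%:R * v3.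
Proof.
move=> GC; pose s := [:: a; b; c; d; e; f; g] => us.
move=> E0 E1 E2 E3 E4 E5 E6 E7 E8 E9 E10 E11 E12 E13 E14 E15 E16 E17 E18 E19 E20.
have -> : \sum_(p <- s) \sum_(q <- s | q != p) G p q =
    \sum_(i < 7) \sum_(j < 7 | j != i) G (nth a s i) (nth a s j).
  rewrite (big_nth a) big_mkord; apply: eq_bigr => i _.
  by rewrite (big_nth a) big_mkord; apply: eq_bigl => j; rewrite nth_uniq.
under eq_bigr do rewrite big_mkcond /=.
rewrite !big_ord_recl !big_ord0 /= (GC b a) !(GC c a) !(GC c b) !(GC d a) !(GC d b) !(GC d c).
rewrite !(GC e a) !(GC e b) !(GC e c) !(GC e d) !(GC f a) !(GC f b) !(GC f c) !(GC f d).
rewrite !(GC f e) !(GC g a) !(GC g b) !(GC g c) !(GC g d) !(GC g e) !(GC g f).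
rewrite E0 E1 E2 E3 E4 E5 E6 E7 E8 E9 E10 E11 E12 E13 E14 E15 E16 E17 E18 E19 E20; ring.
Qed.

Section RhombicDodecahedron.
Variable R : realType.

Lemma unit_rep_line (v : 'rV[R]_3) (v0 : v != 0) :
  exists e : R, e ^+ 2 = (dot v v)^-1 /\ unit_rep (line v0) = e *: v.
Proof.
have d0 := dot_gt0 v0; pose k := (Num.sqrt (dot v v))^-1.
have k2 : k ^+ 2 = (dot v v)^-1 by rewrite exprVn sqr_sqrtr // ltW.
have kv : k *: v \in \val (line v0) by rewrite /= memvZ // memv_line.
have [|e e1 ->] := unit_repE kv.
  by rewrite dotZl dotZr mulrA -expr2 k2 mulVf ?gt_eqF.
by exists (e * k); rewrite exprMn e1 mul1r k2 scalerA.
Qed.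

Lemma dot_vec3 a b c a' b' c' :
  dot (vec3 R a b c) (vec3 R a' b' c') = (a * a' + b * b' + c * c')%:~R.
Proof. by rewrite dotE !mxE /= !intrD !intrM. Qed.

Lemma sqdot_line3 a b c a' b' c' h h' :
  chordal (@line3 R a b c h) (@line3 R a' b' c' h') ^+ 2 =
  1 - (a * a' + b * b' + c * c')%:~R ^+ 2 /
      ((a * a + b * b + c * c)%:~R * (a' * a' + b' * b' + c' * c')%:~R).
Proof.
rewrite chordal_sqr /line3; congr (_ - _).
have [e [e2 ->]] := unit_rep_line (vec3_neq0 R h).
have [e' [e2' ->]] := unit_rep_line (vec3_neq0 R h').
rewrite dotZl dotZr !exprMn e2 e2' !dot_vec3 invfM; ring.
Qed.

Definition rd_seq : seq (RP2 R) :=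
  [:: @line3 R 1 0 0 isT; @line3 R 0 1 0 isT; @line3 R 0 0 1 isT;
      @line3 R 1 1 1 isT; @line3 R 1 1 (-1) isT;
      @line3 R 1 (-1) 1 isT; @line3 R 1 (-1) (-1) isT].

Lemma uniq_rd_seq : uniq rd_seq.
Proof.
rewrite uniq_pairwise /rd_seq [pairwise _ _]/=.
by repeat (apply/andP; split); rewrite ?line3_neq.
Qed.

Lemma perm_rd_seq : perm_eq (enum_fset (rhombic_dodecahedron R)) rd_seq.
Proof.
have mem7 (K : choiceType) (a b c d e f g : K) :
    [fset a; b; c; d; e; f; g]%fset =i [:: a; b; c; d; e; f; g].
  by move=> p; rewrite !inE -!orbA.
apply: uniq_perm; [exact: fset_uniq|exact: uniq_rd_seq|exact: mem7].
Qed.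

Lemma energy_rd f : energy f (rhombic_dodecahedron R) =
  2^-1 * design_energy (fun s => f (1 - s)).
Proof.
rewrite /energy (perm_big _ perm_rd_seq) /=; congr (_ * _).
under eq_bigr do rewrite (perm_big _ perm_rd_seq) /=.
have chC (p q : RP2 R) : f (chordal p q ^+ 2) = f (chordal q p ^+ 2).
  by rewrite !chordal_sqr dotC.
have val0 a b c a' b' c' h h' : a * a' + b * b' + c * c' = 0 ->
    f (chordal (@line3 R a b c h) (@line3 R a' b' c' h') ^+ 2) = f (1 - 0).
  by rewrite sqdot_line3 => ->; rewrite expr0n mul0r.
(* Pairs with t = 1/(k+1), reduced to an identity between integers: [k = 8] for two diagonals,
   [k = 2] for an axis and a diagonal. *)
have val k a b c a' b' c' h h' :
    (a * a' + b * b' + c * c') * (a * a' + b * b' + c * c') * k.+1%:Z =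
    (a * a + b * b + c * c) * (a' * a' + b' * b' + c' * c') ->
    f (chordal (@line3 R a b c h) (@line3 R a' b' c' h') ^+ 2) = f (1 - 1 / k.+1%:R).
  move=> E; rewrite sqdot_line3 -intrM -E intrM invfM mulrA intrM -expr2 mulfV //.
  rewrite expf_eq0 /= intr_eq0; apply: contraTneq h => n0; apply/negP => h.
  have := dot_gt0 (vec3_neq0 R h); have := dot_gt0 (vec3_neq0 R h').
  rewrite !dot_vec3 => d' d; have := mulr_gt0 d d'.
  by rewrite -intrM -E n0 !mul0r ltxx.
by apply: (sum_pairs7 chC uniq_rd_seq);
   solve [exact: val0 | exact: (val 8) | exact: (val 2)].
Qed.

End RhombicDodecahedron.

(** * Rigid codes are images of the rhombic dodecahedron *)

Section RigidConfigurations.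
Variable R : realType.
Variable C : {fset RP2 R}.
Hypothesis card_C : #|` C|%fset = 7%N.
Local Notation x := (code_vector C).

(** The three squared components add up to 1, the squared length of [v], so the difference of [v]
    and its expansion has length zero. *)
Lemma orthonormal_expansion (a b c v : 'rV[R]_3) :
  dot a a = 1 -> dot b b = 1 -> dot c c = 1 -> dot v v = 1 ->
  dot a b = 0 -> dot a c = 0 -> dot b c = 0 ->
  dot a v ^+ 2 = 1 / 3%:R -> dot b v ^+ 2 = 1 / 3%:R -> dot c v ^+ 2 = 1 / 3%:R ->
  v = dot a v *: a + dot b v *: b + dot c v *: c.
Proof.
move=> aa bb cc vv ab ac bc av bv cv.
set w := _ + _ + _; have E : dot (v - w) (v - w) = 0.
  have dotDr p q r : dot p (q + r) = dot p q + dot p r :> R by rewrite dotC dotDl !(dotC _ p).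
  have dotNr p q : dot p (- q) = - dot p q :> R by rewrite dotC dotNl dotC.
  rewrite /w !(dotDl, dotNl, dotDr, dotNr, dotZl, dotZr).
  rewrite (dotC b a) (dotC c a) (dotC c b) (dotC v a) (dotC v b) (dotC v c).
  by rewrite aa bb cc vv ab ac bc; move: av bv cv; rewrite !expr2; lra.
apply/eqP; rewrite -subr_eq0; apply: contraPT E => /dot_gt0.
by move=> /gt_eqF/negbT/eqP.
Qed.

Lemma rd_mem k : (k < 7)%N ->
  nth (@line3 R 1 0 0 isT) (rd_seq R) k \in rhombic_dodecahedron R.
Proof. by move=> k7; rewrite [_ \in _](perm_mem (perm_rd_seq R)) mem_nth. Qed.

(** An orthonormal triple of the code gives the images of the axes. Any other code vector has
    components equal up to sign in this basis, hence spans the image of a diagonal. *)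
Lemma rigid_isometric : rigid x -> isometric (rhombic_dodecahedron R) C.
Proof.
move=> rigid_x; have x1 := @code_vector1 R C.
have [a [b [c [_ ab ac bc others]]]] := orthonormal_triple x1 rigid_x.
(* Matrices act on row vectors from the right, so the rows of [M] are the images of the standard
   basis. *)
pose M : 'M[R]_3 := \matrix_(i, j) ([:: x a; x b; x c]`_i) 0 j.
have MM : M *m M^T == 1%:M.
  apply/eqP/matrixP => i j; rewrite !mxE.
  transitivity (dot ([:: x a; x b; x c]`_i) ([:: x a; x b; x c]`_j)).
    by apply: eq_bigr => k _; rewrite !mxE.
  by case: i => [[|[|[|//]]] ?]; case: j => [[|[|[|//]]] ?];
     rewrite /= ?x1 ?(dotC (x b) (x a)) ?(dotC (x c)) ?ab ?ac ?bc.
pose A : O3 R := exist _ M MM.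
have vecM p q r : vec3 R p q r *m M = p%:~R *: x a + q%:~R *: x b + r%:~R *: x c.
  apply/rowP => j; rewrite !mxE !big_ord_recl big_ord0 !mxE /= addr0.
  by rewrite addrA.
have image p q r h l (k : R) : k != 0 -> p%:~R *: x a + q%:~R *: x b + r%:~R *: x c = k *: x l ->
    RP2_isometry A (@line3 R p q r h) = code_point C l.
  move=> k0 E; apply/val_inj; rewrite -[RHS]line_unit_rep /= limg_line lfunE /= vecM E.
  apply/eqP; rewrite eqEdim -memvE memvZ ?memv_line // !dim_vline (scaler_eq0 k) (negPf k0) /=.
  by case: eqP.
have covered l : exists2 p, p \in rhombic_dodecahedron R & code_point C l = RP2_isometry A p.
  have [->|la] := eqVneq l a.
    exists (@line3 R 1 0 0 isT); first exact: (@rd_mem 0).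
    by rewrite (@image _ _ _ _ a 1) ?oner_neq0 // !scale1r !scale0r !addr0.
  have [->|lb] := eqVneq l b.
    exists (@line3 R 0 1 0 isT); first exact: (@rd_mem 1).
    by rewrite (@image _ _ _ _ b 1) ?oner_neq0 // !scale1r !scale0r addr0 add0r.
  have [->|lc] := eqVneq l c.
    exists (@line3 R 0 0 1 isT); first exact: (@rd_mem 2).
    by rewrite (@image _ _ _ _ c 1) ?oner_neq0 // !scale1r !scale0r !add0r.
  have [|al bl cl] := others l; first by rewrite !inE !negb_or la lb lc.
  have E := orthonormal_expansion (x1 a) (x1 b) (x1 c) (x1 l) ab ac bc al bl cl.
  move: al bl cl E; rewrite /sqdot;
  move: (dot (x a) (x l)) (dot (x b) (x l)) (dot (x c) (x l)) => s s' s'' s2 s2' s2'' E.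
  have s0 : s != 0 by rewrite -sqrf_eq0 s2 mulf_neq0 ?oner_neq0 // invr_eq0 pnatr_eq0.
  (* With [s] factored out, [x l] is [s] times [x a] plus or minus [x b] plus or minus [x c]. *)
  have fin p q h : p ^+ 2 = 1 :> int -> q ^+ 2 = 1 :> int -> s' = s * p%:~R -> s'' = s * q%:~R ->
      RP2_isometry A (@line3 R 1 p q h) = code_point C l.
    move=> _ _ Ep Eq; apply: (@image _ _ _ _ _ s^-1); first by rewrite invr_eq0.
    rewrite E Ep Eq; move: (x a) (x b) (x c) => xa xb xc.
    by rewrite !scalerDr !scalerA !mulrA mulVf // scale1r !mul1r.
  have /orP[/eqP Ep|/eqP Ep] : (s' == s) || (s' == - s) by rewrite -eqf_sqr s2 s2'.
  - have /orP[/eqP Eq|/eqP Eq] : (s'' == s) || (s'' == - s) by rewrite -eqf_sqr s2 s2''.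
    + exists (@line3 R 1 1 1 isT); first exact: (@rd_mem 3).
      by rewrite fin // ?Ep ?Eq mulr1.
    + exists (@line3 R 1 1 (-1) isT); first exact: (@rd_mem 4).
      by rewrite fin // ?Ep ?Eq ?rmorphN1 ?mulrN1 ?mulr1.
  - have /orP[/eqP Eq|/eqP Eq] : (s'' == s) || (s'' == - s) by rewrite -eqf_sqr s2 s2''.
    + exists (@line3 R 1 (-1) 1 isT); first exact: (@rd_mem 5).
      by rewrite fin // ?Ep ?Eq ?rmorphN1 ?mulrN1 ?mulr1.
    + exists (@line3 R 1 (-1) (-1) isT); first exact: (@rd_mem 6).
      by rewrite fin // ?Ep ?Eq ?rmorphN1 ?mulrN1 ?mulr1.
(* The code is contained in the image, which has at most 7 points. *)
exists A; apply/eqP; rewrite eqEfcard; apply/andP; split.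
  apply/fsubsetP => p /(code_pointP card_C)[l ->]; have [q qR ->] := covered l.
  exact: in_imfset.
by rewrite card_C (leq_trans (leq_imfset_card _ _ _)) // card_rhombic_dodecahedron.
Qed.

End RigidConfigurations.

(** * Completely monotonic functions *)

Section AbsoluteMonotonicity.
Variable R : realType.
Local Open Scope classical_set_scope.
Local Open Scope ring_scope.

(** By the mean value theorem; continuity at 0 is a separate assumption because derivatives are
    given on the open interval only. *)
Lemma nondecreasing01 (h h' : R -> R) :
  (forall x : R, 0 < x < 1 -> is_derive x 1 h (h' x)) -> h y @[y --> 0^'+] --> h 0 ->
  (forall x, 0 < x < 1 -> 0 <= h' x) -> forall a b, 0 <= a -> a <= b -> b < 1 -> h a <= h b.
Proof.
move=> dh c0 h'0 a b a0; rewrite le_eqVlt => /predU1P[-> //|ab b1].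
have in01 c : a < c -> c < b -> 0 < c < 1.
  by move=> ac cb; rewrite (le_lt_trans a0 ac) (lt_trans cb b1).
have cont x : 0 < x < 1 -> {for x, continuous h}.
  move=> x01; apply/differentiable_continuous/derivable1_diffP.
  by have [] := dh x x01.
have [c||c cab E] := @MVT _ h h' a b ab.
- by rewrite in_itv /= => /andP[ac cb]; apply: dh; exact: in01.
- apply/continuous_within_itvP => //; split.
  + by move=> c; rewrite in_itv /= => /andP[ac cb]; apply: cont; exact: in01.
  + move: a0; rewrite le_eqVlt => /predU1P[<- //|a0].
    by apply: cvg_at_right_filter; apply: cont; rewrite a0 (lt_trans ab b1).
  + by apply: cvg_at_left_filter; apply: cont; rewrite b1 (le_lt_trans a0 ab).
rewrite -subr_ge0 E mulr_ge0 ?subr_ge0 ?(ltW ab) // h'0 //.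
by move: cab; rewrite in_itv /= => /andP[]; exact: in01.
Qed.

(* [G k] plays the role of the [k]-th derivative of [G 0] on [0, 1[ . *)
Definition monotone_chain (G : nat -> R -> R) : Prop :=
  [/\ forall k (x : R), 0 < x < 1 -> is_derive x 1 (G k) (G k.+1 x),
      forall k, G k y @[y --> 0^'+] --> G k 0 &
      forall k x, 0 <= x < 1 -> 0 <= G k x].

Definition taylor (G : nat -> R -> R) (n : nat) : {poly R} := \poly_(k < n) (G k 0 / k`!%:R).

Definition remainder G n s : R := G 0%N s - (taylor G n).[s].

Lemma taylor_deriv G n : (taylor G n.+1)^`() = taylor (fun k => G k.+1) n.
Proof.
apply/polyP => k; rewrite coef_deriv !coef_poly ltnS.
case: ltnP => // _; last by rewrite mul0rn.
rewrite -[_ *+ k.+1]mulr_natr factS natrM.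
have fk : k`!%:R != 0 :> R by rewrite pnatr_eq0 -lt0n fact_gt0.
have k1 : k.+1%:R != 0 :> R by rewrite pnatr_eq0.
by move: (k.+1%:R) (k`!%:R) k1 fk => p q p0 q0; field; rewrite p0 q0.
Qed.

Lemma taylor_at0 G n : (taylor G n.+1).[0] = G 0%N 0.
Proof. by rewrite horner_coef0 coef_poly /= divr1. Qed.

(** Bernstein's argument: remainder over s^n is nondecreasing, a fact stated here without division.
    The induction passes to the shifted chain, whose remainder of order n is the derivative of the
    remainder of order n+1. *)
Lemma remainder_bound n G : monotone_chain G -> forall s lam, 0 <= s < 1 -> 0 < lam <= 1 ->
  0 <= remainder G n s /\ remainder G n (lam * s) <= lam ^+ n * remainder G n s.
Proof.
elim: n G => [|n IH] G chG s lam /andP[s0 s1] /andP[lam0 lam1]; have [dG cG pG] := chG.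
  have E t : remainder G 0 t = G 0%N t.
    by rewrite /remainder /taylor poly_def big_ord0 horner0 subr0.
  rewrite !E expr0 mul1r pG ?s0 //; split=> //.
  apply: (nondecreasing01 (dG 0%N) (cG 0%N)) => //.
  - by move=> x /andP[x0 x1]; rewrite pG // ltW.
  - by rewrite mulr_ge0 // ltW.
  - by rewrite ler_piMl.
have chS : monotone_chain (fun k => G k.+1).
  by split=> [k|k|k]; [exact: dG|exact: cG|exact: pG].
have rem0 : remainder G n.+1 0 = 0 by rewrite /remainder taylor_at0 subrr.
have dr (x : R) : 0 < x < 1 -> is_derive x 1 (remainder G n.+1) (remainder (fun k => G k.+1) n x).
  move=> x01; rewrite /remainder -taylor_deriv; apply: is_deriveB.
  exact: dG.
have cT : (taylor G n.+1).[y] @[y --> 0^'+] --> (taylor G n.+1).[0].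
  by apply: cvg_at_right_filter; exact: continuous_horner.
have cr : remainder G n.+1 y @[y --> 0^'+] --> remainder G n.+1 0.
  by apply: cvgB.
split.
  rewrite -rem0; apply: (nondecreasing01 dr cr) => // x /andP[x0 x1].
  by have [] := IH _ chS x 1; rewrite ?ltr01 ?lexx ?(ltW x0).
(* [psi] vanishes at 0, and its derivative is [lam] times the difference estimated by the induction
   hypothesis. *)
pose psi t := lam ^+ n.+1 * remainder G n.+1 t - remainder G n.+1 (lam * t).
suff : psi 0 <= psi s by rewrite /psi mulr0 rem0 mulr0 subrr subr_ge0.
apply: (@nondecreasing01 psi (fun x => lam ^+ n.+1 * remainder (fun k => G k.+1) n x
    - lam * remainder (fun k => G k.+1) n (lam * x))) => //.
- move=> x x01.
  have lx01 : 0 < lam * x < 1.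
    by case/andP: x01 => x0 x1; rewrite mulr_gt0 //= (le_lt_trans _ x1) // ler_piMl // ltW.
  have dlam : is_derive x 1 ( *%R lam) lam.
    by rewrite -[X in is_derive _ _ _ X]mulr1; exact: (@is_deriveZ _ _ _ id lam).
  rewrite [X in _ - X]mulrC.
  have -> : psi = lam ^+ n.+1 *: remainder G n.+1 - (remainder G n.+1 \o *%R lam) by [].
  apply: is_deriveB; first by apply: is_deriveZ; exact: dr.
  by apply: is_derive1_comp; exact: dr.
- rewrite /psi; apply: cvgB; first by apply: cvgM => //; exact: cvg_cst.
  rewrite mulr0; apply: cvg_comp cr => A [e /= e0 eA].
  exists e => //= y; rewrite /ball /= sub0r normrN => ye y0.
  apply: eA; rewrite /= ?mulr_gt0 // sub0r normrN normrM (le_lt_trans _ ye) //.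
  by rewrite ler_piMl // gtr0_norm.
- move=> x /andP[x0 x1]; rewrite subr_ge0 exprS -mulrA ler_pM2l //.
  by have [] := IH _ chS x lam; rewrite ?(ltW x0) ?lam0.
Qed.

Lemma taylor_nneg G n : monotone_chain G -> nneg_coef (taylor G n).
Proof.
move=> [_ _ pG] k; rewrite coef_poly; case: ifP => // _.
by rewrite divr_ge0 ?ler0n // pG // lexx ltr01.
Qed.

(** Writing t = [lam * b] with [b < 1], the remainder at t is at most [lam ^+ n] times the remainder
    at [b], which is at most [G 0 b]. *)
Lemma taylor_cvg G t : monotone_chain G -> 0 <= t < 1 ->
  (taylor G n).[t] @[n --> \oo] --> G 0%N t.
Proof.
move=> chG t01.
(* For t > 0, [b] is the midpoint of t and 1; t = 0 is separate because [lam] has to be positive. *)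
have [b [lam [b01 lam01 tE]]] : exists b lam : R, [/\ 0 <= b < 1, 0 < lam < 1 & t = lam * b].
  case/andP: t01; rewrite le_eqVlt => /predU1P[<- _|t0 t1].
    by exists 0, (1 / 2%:R); rewrite lexx ltr01 mulr0; split => //; lra.
  exists ((1 + t) / 2%:R), (t / ((1 + t) / 2%:R)); split; first by lra.
    by rewrite divr_gt0 ?ltr_pdivrMr; lra.
  by rewrite divfK // gt_eqF //; lra.
have lam01' : 0 < lam <= 1 by case/andP: lam01 => -> /ltW.
suff rc : remainder G n t @[n --> \oo] --> 0.
  have -> : (fun n => (taylor G n).[t]) = (fun n => G 0%N t - remainder G n t).
    by apply/funext => n; rewrite /remainder; ring.
  by rewrite -[X in _ --> X]subr0; apply: cvgB => //; exact: cvg_cst.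
apply: (@squeeze_cvgr _ _ _ _ (fun=> 0) (fun n => lam ^+ n * G 0%N b)).
- near=> n; have [r0 _] := remainder_bound n chG t01 lam01'; rewrite r0 /=.
  have [_] := remainder_bound n chG b01 lam01'; rewrite -tE => /le_trans; apply.
  case/andP: lam01 => l0 _; rewrite ler_pM2l ?exprn_gt0 // gerBl.
  by apply: nneg_horner; [exact: taylor_nneg|case/andP: b01].
- exact: cvg_cst.
- rewrite -[X in _ --> X](mul0r (G 0%N b)); apply: cvgM; last exact: cvg_cst.
  by apply: cvg_expr; case/andP: lam01 => l0 l1; rewrite gtr0_norm.
Unshelve. all: by end_near.
Qed.

(** * Completely monotonic functions reflected to absolutely monotonic ones *)

Section CompletelyMonotonic.
Variable f : R -> R.
Hypothesis cm : completely_monotonic f.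
Local Notation D := [set` `]0, 1]].
Local Notation F k := (deriven_within D k f).

(** The [k]-th derivative of t -> f(1 - t); the sign from the chain rule is the one in complete
    monotonicity. *)
Definition reflected (k : nat) (t : R) : R := (-1) ^+ k * F k (1 - t).

Lemma diff_quotient_cvg k x : D x ->
  diff_quotient (F k) x y @[y --> within D x^'] --> F k.+1 x.
Proof. by move=> Dx; have [+ _] := cm => /(_ k x Dx). Qed.

Lemma reflected_is_derive k (x : R) : 0 < x < 1 ->
  is_derive x 1 (reflected k) (reflected k.+1 x).
Proof.
move=> /andP[x0 x1].
suff H : h^-1 *: ((reflected k \o shift x) (h *: (1 : R)) - reflected k x) @[h --> 0^']
    --> reflected k.+1 x.
  by apply: DeriveDef; [apply/cvg_ex; exists (reflected k.+1 x)|exact: cvg_lim].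
have Dx : D (1 - x) by rewrite /= in_itv /=; apply/andP; split; lra.
(* Near the interior point [1 - x] small increments stay in [D], so the derivative within [D] is the
   two-sided one. *)
have sh : (1 - x - h) @[h --> 0^'] --> within D (1 - x)^'.
  move=> A [e /= e0 eA]; exists (Num.min e (Num.min x (1 - x))) => [|h] /=.
    by rewrite !lt_min e0 x0 subr_gt0 x1.
  rewrite /ball /= sub0r normrN !lt_min => /and3P[he hx hx1] h0; apply: eA.
  - by rewrite /= opprB addrC subrK.
  - by rewrite -subr_eq0 addrC addKr oppr_eq0.
  - move: hx hx1; rewrite !ltr_norml in_itv /= => /andP[? ?] /andP[? ?].
    by apply/andP; split; lra.
have := cvg_comp _ _ sh (diff_quotient_cvg (k := k) Dx).
move=> /(cvgM (cvg_cst ((-1) ^+ k.+1 : R))); rewrite -/(reflected k.+1 x).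
apply: cvg_trans; apply: near_eq_cvg; near=> h.
have h0 : h != 0 by near: h; exact: nbhs_dnbhs_neq.
rewrite /= /diff_quotient /reflected /shift /= /GRing.scale /= mulr1 exprS.
rewrite (_ : 1 - (h + x) = 1 - x - h); last by ring.
rewrite (_ : 1 - x - h - (1 - x) = - h); last by ring.
by rewrite invrN; ring.
Unshelve. all: by end_near.
Qed.

(** The one-sided derivative at 1 gives continuity there: F(1 - y) is F(1) minus y times a
    convergent difference quotient. *)
Lemma reflected_cvg0 k : reflected k y @[y --> 0^'+] --> reflected k 0.
Proof.
have D1 : D (1 : R) by rewrite /= in_itv /= ltr01 lexx.
have sh : (1 - h) @[h --> (0:R)^'+] --> within D (1:R)^'.
  move=> A [e /= e0 eA]; exists (Num.min e 1) => [|h] /=; first by rewrite lt_min e0 ltr01.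
  rewrite /ball /= sub0r normrN lt_min => /andP[he h1] h0; apply: eA.
  - by rewrite /= opprB addrC subrK.
  - by rewrite lt_eqF // gtrBl.
  - by rewrite in_itv /= subr_gt0 gerBl (ltW h0) andbT; move: h1; rewrite gtr0_norm.
have dq := cvg_comp _ _ sh (diff_quotient_cvg (k := k) D1).
have id0 : y @[y --> (0:R)^'+] --> (0:R) by apply: cvg_at_right_filter; exact: cvg_id.
have E : F k (1 - y) @[y --> (0:R)^'+] --> F k 1.
  have E0 : F k 1 - diff_quotient (F k) 1 (1 - y) * y @[y --> (0:R)^'+] --> F k 1.
    rewrite -[X in _ --> X]subr0 -[X in _ --> _ - X](mulr0 (F k.+1 1)).
    by apply: cvgB; [exact: cvg_cst|apply: cvgM; [exact: dq|exact: id0]].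
  apply: cvg_trans E0; apply: near_eq_cvg; near=> y.
  have y0 : y != 0 by rewrite gt_eqF //; near: y; exact: nbhs_right_gt.
  rewrite /= /diff_quotient (_ : 1 - y - 1 = - y); last by ring.
  by rewrite invrN mulrN mulNr mulfVK //; ring.
by rewrite /reflected subr0; apply: cvgM => //; exact: cvg_cst.
Unshelve. all: by end_near.
Qed.

Lemma reflected_chain : monotone_chain reflected.
Proof.
split=> [k x|k|k x /andP[x0 x1]]; [exact: reflected_is_derive|exact: reflected_cvg0|].
by have [_ +] := cm; apply; rewrite /= in_itv /=; apply/andP; split; lra.
Qed.

End CompletelyMonotonic.

End AbsoluteMonotonicity.

(** * Optimality *)

Section UniversalOptimality.
Variable R : realType.
Local Open Scope classical_set_scope.
Local Open Scope ring_scope.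

Lemma cvg_sum_cond (I : Type) (r : seq I) (P : pred I) (u : I -> nat -> R) (l : I -> R) :
  (forall i, P i -> u i n @[n --> \oo] --> l i) ->
  \sum_(i <- r | P i) u i n @[n --> \oo] --> \sum_(i <- r | P i) l i.
Proof.
move=> ul; elim: r => [|i r IH].
  by under eq_fun do rewrite big_nil; rewrite big_nil; exact: cvg_cst.
under eq_fun do rewrite big_cons; rewrite big_cons; case: ifPn => // Pi.
by apply: cvgD => //; exact: ul.
Qed.

Variables (f : R -> R) (C : {fset RP2 R}).
Hypothesis cm : completely_monotonic f.
Hypothesis card_C : #|` C|%fset = 7%N.
Local Notation x := (code_vector C).
Local Notation T := (taylor (reflected f)).

Let x1 := @code_vector1 R C.
Let chain := reflected_chain cm.

Definition excess (F : R -> R) : R := pair_sum x F - design_energy F.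

Lemma taylor_cvg_f (t : R) : 0 <= t < 1 -> (T n).[t] @[n --> \oo] --> f (1 - t).
Proof. by move=> /(taylor_cvg chain); rewrite /reflected expr0 mul1r. Qed.

Lemma excess_cvg : excess (fun s => (T n).[s]) @[n --> \oo] --> excess (fun s => f (1 - s)).
Proof.
apply: cvgB.
  apply: cvg_sum_cond => i _; apply: cvg_sum_cond => j ji; apply: taylor_cvg_f.
  by rewrite sqdot_ge0 sqdot_code_lt1.
have c (a t : R) : 0 <= t < 1 -> a * (T n).[t] @[n --> \oo] --> a * f (1 - t).
  by move=> t01; apply: cvgM; [exact: cvg_cst|exact: taylor_cvg_f].
by rewrite /design_energy; apply: cvgD; first apply: cvgD; apply: c; lra.
Qed.

(** The difference of two Taylor polynomials has nonnegative coefficients, so its own excess is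
    nonnegative. *)
Lemma excess_mono m n : (m <= n)%N ->
  excess (fun s => (T m).[s]) <= excess (fun s => (T n).[s]).
Proof.
move=> mn; pose q := T n - T m.
have q0 : nneg_coef q.
  move=> k; rewrite /q coefB !coef_poly; case: (ltnP k m) => km.
    by rewrite (leq_trans km mn) subrr.
  have := taylor_nneg n chain k; rewrite coef_poly => h; by rewrite subr0.
have [+ _] := poly_energy x1 q0; rewrite -subr_ge0 -[X in _ <= X -> _]/(excess (fun s => q.[s])).
have -> : excess (fun s => q.[s]) = excess (fun s => (T n).[s]) - excess (fun s => (T m).[s]).
  rewrite /excess /q (@eq_pair_sum _ _ _ (fun s => (T n).[s] + -1 * (T m).[s])); last first.
    by move=> s; rewrite !hornerE mulN1r.
  by rewrite pair_sumD pair_sumZ /design_energy !hornerE; ring.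
by rewrite subr_ge0.
Qed.

Lemma excess_ge n : excess (fun s => (T n).[s]) <= excess (fun s => f (1 - s)).
Proof.
apply: (cvgr_to_ge excess_cvg); near=> m; apply: excess_mono.
by near: m; exact: nbhs_infty_ge.
Unshelve. all: by end_near.
Qed.

Lemma excess_taylor_ge0 n : 0 <= excess (fun s => (T n).[s]).
Proof. by have [+ _] := poly_energy x1 (taylor_nneg n chain); rewrite -subr_ge0. Qed.

Lemma energy_excess :
  energy f C - energy f (rhombic_dodecahedron R) = 2^-1 * excess (fun s => f (1 - s)).
Proof. by rewrite (energyE card_C) energy_rd -mulrBr. Qed.

Lemma universally_optimal : energy f (rhombic_dodecahedron R) <= energy f C.
Proof.
rewrite -subr_ge0 energy_excess mulr_ge0 ?invr_ge0 ?ler0n //.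
exact: le_trans (excess_taylor_ge0 0) (excess_ge 0).
Qed.

Lemma linear_of_taylor : (forall n, (size (T n) <= 2)%N) -> linear_function f.
Proof.
move=> sz; pose a0 := (T 2)`_0; pose a1 := (T 2)`_1.
(* From order 2 on, the first two coefficients no longer change. *)
have TE n t : (T n.+2).[t] = a0 + a1 * t.
  rewrite (@horner_coef_wide _ 2) // !big_ord_recl big_ord0 /= expr0 mulr1 expr1 addr0.
  by rewrite /a0 /a1 /bump !coef_poly.
exists ((a0 + a1)%:P - a1 *: 'X).
  rewrite (leq_trans (size_polyD _ _)) // geq_max (leq_trans (size_polyC_leq1 _)) //=.
  by rewrite size_polyN (leq_trans (size_scale_leq _ _)) // size_polyX.
move=> s; rewrite in_itv /= => /andP[s0 s1].
have t01 : 0 <= 1 - s < 1 by apply/andP; split; lra.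
have := taylor_cvg_f t01; rewrite -(cvg_shiftn 2) /=.
under eq_fun do rewrite addn2 TE.
move=> /(cvg_unique _ (cvg_cst _)); rewrite subKr => <- //.
by rewrite !hornerE; ring.
Qed.

(** Some Taylor polynomial has degree at least 2. Its excess lies between 0 and that of the
    potential, which is 0, so the equality case for polynomials applies. *)
Lemma uniquely_optimal : ~ linear_function f ->
  energy f C = energy f (rhombic_dodecahedron R) -> isometric (rhombic_dodecahedron R) C.
Proof.
move=> nlin eqE; apply: rigid_isometric => //.
have [n sn] : exists n, (2 < size (T n))%N.
  apply: contrapT => no; apply: nlin; apply: linear_of_taylor => n.
  by rewrite leqNgt; apply/negP => sn; apply: no; exists n.
have [_ +] := poly_energy x1 (taylor_nneg n chain); apply => //.
apply/eqP; rewrite -subr_eq0 eq_le [X in _ && X]excess_taylor_ge0 andbT.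
apply: le_trans (excess_ge n) _; have := energy_excess.
by rewrite eqE subrr => /esym/eqP; rewrite mulf_eq0 invr_eq0 pnatr_eq0 /= => /eqP->.
Qed.

End UniversalOptimality.

(** * The optimal seven-point code *)

Section OptimalCode.
Variable R : realType.
Local Notation RD := (rhombic_dodecahedron R).

Lemma min_dist_rd_ge0 : 0 <= min_dist RD.
Proof.
have [|p [q [_ _ _ ->]]] := @min_dist_attained R RD; last exact: chordal_ge0.
by rewrite card_rhombic_dodecahedron.
Qed.

Lemma min_dist_rd : 2%:R / 3%:R <= min_dist RD ^+ 2.
Proof.
have card_RD := card_rhombic_dodecahedron R.
have [|p [q [pR qR qp ->]]] := @min_dist_attained R RD; first by rewrite card_RD.
have [i Ei] := code_pointP card_RD pR; have [j Ej] := code_pointP card_RD qR.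
have ji : j != i by apply: contra qp => /eqP ij; rewrite Ei Ej ij.
(* The indicator of squared distances below 2/3 has energy 0, so the energy formula rules out such
   pairs. *)
pose f (s : R) : R := ((s < 2%:R / 3%:R)%R)%:R.
have f0 : pair_sum (code_vector RD) (fun s => f (1 - s)) = 0.
  have := energyE card_RD f; rewrite energy_rd => /esym/(mulfI _) ->.
    have le0 : 2%:R / 3%:R <= 1 - 0 :> R by lra.
    have le9 : 2%:R / 3%:R <= 1 - 1 / 9%:R :> R by lra.
    have le3 : 2%:R / 3%:R <= 1 - 1 / 3%:R :> R by lra.
    by rewrite /design_energy /f !ltNge le0 le9 le3 /= !mulr0 !addr0.
  by rewrite invr_eq0 pnatr_eq0.
have := @pair_sum_eq0 _ _ (fun s => f (1 - s)) (fun _ _ _ => ler0n _ _) f0 i j ji.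
by rewrite /f; case: ltP => [_ /eqP|+ _]; rewrite ?oner_eq0 // Ei Ej chordal_sqr.
Qed.

Section Code.
Variable C : {fset RP2 R}.
Hypothesis card_C : #|` C|%fset = 7%N.

Lemma sqdot_le_of_min_dist : min_dist RD <= min_dist C ->
  forall i j, j != i -> sqdot (code_vector C) i j <= 1 - min_dist C ^+ 2.
Proof.
move=> le_m i j ji; have h : min_dist C <= chordal (code_point C i) (code_point C j).
  by apply: min_dist_le; rewrite ?code_point_in // (inj_eq (code_point_inj card_C)).
rewrite lerBrDr -lerBrDl -chordal_sqr ler_sqr ?nnegrE ?chordal_ge0 //.
exact: le_trans min_dist_rd_ge0 le_m.
Qed.

Lemma rigid_of_min_dist : min_dist RD <= min_dist C -> rigid (code_vector C).
Proof.
move=> le_m; apply: rigid_of_small_sqdot; first exact: code_vector1.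
move=> i j ji; apply: le_trans (sqdot_le_of_min_dist le_m ji) _.
have h := min_dist_rd; have m0 := min_dist_rd_ge0.
have : min_dist RD ^+ 2 <= min_dist C ^+ 2 by rewrite ler_sqr ?nnegrE // (le_trans m0).
lra.
Qed.

Lemma min_dist_optimal : min_dist C <= min_dist RD.
Proof.
rewrite leNgt; apply/negP => lt_m.
have [t3 ts] := rigid_of_min_dist (ltW lt_m).
have m0 := min_dist_rd_ge0.
have lt2 : min_dist RD ^+ 2 < min_dist C ^+ 2.
  by rewrite ltr_sqr ?nnegrE // (le_trans m0) // ltW.
(* A larger minimal distance would exclude t = 1/3, so the six values at a point would sum to at
   most 6/9, less than the 4/3 of a tight frame. *)
have : \sum_(j < 7 | j != 0) sqdot (code_vector C) 0 j <= \sum_(j < 7 | j != 0) 1 / 9%:R.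
  apply: ler_sum => j j0; have := sqdot_le_of_min_dist (ltW lt_m) j0.
  have := min_dist_rd; case/or3P: (t3 0 j j0) => /eqP -> *; lra.
rewrite ts sumr_const card_neq; lra.
Qed.

Lemma min_dist_unique : min_dist C = min_dist RD -> isometric RD C.
Proof. by move=> E; apply: rigid_isometric => //; apply: rigid_of_min_dist; rewrite E. Qed.

End Code.
End OptimalCode.

Local Open Scope fset_scope.

Theorem theorem1 (R : realType) :
  [/\ forall (f : R -> R), completely_monotonic f ->
      forall C : {fset RP2 R}, #|` C| = 7%N ->
        energy f (rhombic_dodecahedron R) <= energy f C,
      forall (f : R -> R), completely_monotonic f -> ~ linear_function f ->
      forall C : {fset RP2 R}, #|` C| = 7%N ->
        energy f C = energy f (rhombic_dodecahedron R) ->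
        isometric (rhombic_dodecahedron R) C
    & (forall C : {fset RP2 R}, #|` C| = 7%N ->
        min_dist C <= min_dist (rhombic_dodecahedron R)) /\
      (forall C : {fset RP2 R}, #|` C| = 7%N ->
        min_dist C = min_dist (rhombic_dodecahedron R) ->
        isometric (rhombic_dodecahedron R) C)].
Proof.
split=> [f cm C cC|f cm nlin C cC|].
- exact: universally_optimal.
- exact: uniquely_optimal.
- by split=> C cC; [exact: min_dist_optimal|exact: min_dist_unique].
Qed.
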